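(* There is an absolute constant $C>0$ such that the following holds. Let $1\le k\le n$ be integers, let $N\in\mathbb{N}$, and let $\mathcal{V}:[-1,1]\to \mathrm{Gr}(n,k)$ be a trajectory of $k$-dimensional subspaces of $\mathbb{R}^n$, with $D(t)\in\mathbb{R}^{n\times n}$ the orthogonal projector onto $\mathcal{V}(t)$. Let $t_i=\cos\left(\frac{2i+1}{2N+2}\pi\right)$, $i=0,\dots,N$, be the Chebyshev nodes, let $V_i\in\mathrm{St}(n,k)$ be representatives of $\mathcal{V}(t_i)$ (so $V_iV_i^\top=D(t_i)$), and let $V_\bullet\in\mathrm{St}(n,k)$ be a representative of the chosen base point $[V_\bullet]\in\mathrm{Gr}(n,k)$. Assume that: (i) the entries of $t\mapsto D(t)$ are real analytic on $[-1,1]$; (ii) for every $t\in[-1,1]$ and every Stiefel representative $V(t)$ of $\mathcal{V}(t)$, the $k\times k$ matrix $V(t)^\top V_\bullet$ is not rank-deficient (so the Riemannian logarithm from $V_\bullet$ is defined along the whole trajectory); (iii) the tangent vectors $\Delta(t)=\mathrm{Log}_{[V_\bullet]}(V(t))\in\mathbb{R}^{n\times k}$ are uniformly of full rank: there is $\sigma_{\min}>0$ with $\sigma_k(\Delta(t))\ge\sigma_{\min}$ for all $t\in[-1,1]$, where $\sigma_k$ denotes the $k$-th (smallest) singular value. Let $\widetilde\Delta(t)=\sum_{j=0}^N \ell_j(t)\,\Delta_j$ with $\Delta_j=\mathrm{Log}_{[V_\bullet]}(V_j)$ and $\ell_j$ the Lagrange basis polynomials of the nodes $t_0,\dots,t_N$,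 and let $\widetilde V(t)=\mathrm{Exp}_{[V_\bullet]}(\widetilde\Delta(t))$ be the resulting interpolant. Then for every $t\in[-1,1]$ and every Stiefel representative $V(t)$ of $\mathcal{V}(t)$, $$\left\|V(t)V(t)^\top-\widetilde V(t)\widetilde V(t)^\top\right\|_F\le 4\left(\frac{4C}{\sigma_{\min}}+1\right)\frac{\max_{\tau\in[-1,1]}\|\Delta^{(N+1)}(\tau)\|_F}{2^N\,(N+1)!}.$$
   Context: $\mathrm{St}(n,k)=\{V\in\mathbb{R}^{n\times k}: V^\top V=I_k\}$ is the Stiefel manifold. $\mathrm{Gr}(n,k)$ is the set of $k$-dimensional subspaces of $\mathbb{R}^n$, identified with the set of classes $[V]=\{VQ: Q\in\mathbb{R}^{k\times k}\text{ orthogonal}\}$, $V\in\mathrm{St}(n,k)$, and with the rank-$k$ orthogonal projectors $D=VV^\top$. A Stiefel representative of a subspace $\mathcal{V}$ is any $V\in \mathrm{St}(n,k)$ with column space $\mathcal{V}$. The tangent space at $[V_\bullet]$, represented by horizontal lifts at $V_\bullet$, is $T_{[V_\bullet]}\mathrm{Gr}(n,k)=\{\Delta\in\mathbb{R}^{n\times k}: V_\bullet^\top\Delta=0\}$. $\|\cdot\|_F$ is the Frobenius norm. Grassmann logarithm: for $V\in\mathrm{St}(n,k)$ with $V_\bullet^\top V$ invertible, let $L=V(V_\bullet^\top V)^{-1}-V_\bullet$ with thin SVD $L=U\xi W^\top$ ($U\in\mathbb{R}^{n\times k}$, $\xi\in\mathbb{R}^{k\times k}$ diagonal nonnegative, $W\in\mathbb{R}^{k\times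 k}$ orthogonal); then $\mathrm{Log}_{[V_\bullet]}(V)=U\arctan(\xi)W^\top$, with $\arctan$ applied to the diagonal entries. This does not depend on the choice of SVD or of the representative $V$ of $[V]$. Grassmann exponential: for $\Delta\in T_{[V_\bullet]}\mathrm{Gr}(n,k)$ with thin SVD $\Delta=U\xi W^\top$, $\mathrm{Exp}_{[V_\bullet]}(\Delta)=V_\bullet W\cos(\xi)W^\top+U\sin(\xi)W^\top\in \mathbb{R}^{n\times k}$, with $\cos,\sin$ applied to the diagonal entries. This does not depend on the choice of SVD. Lagrange basis polynomials: $\ell_j(t)=\prod_{i\neq j}\frac{t-t_i}{t_j-t_i}$. $\Delta^{(N+1)}$ denotes the entrywise $(N+1)$-th derivative of $t\mapsto\Delta(t)$. ''Absolute constant'' means independent of $n,k,N$, of the trajectory and of the base point. *)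

(* Defs.v *)
From HB Require Import structures.
From mathcomp Require Import all_boot all_order all_algebra.
From mathcomp Require Import all_classical all_reals all_analysis.

Set Implicit Arguments.
Unset Strict Implicit.
Unset Printing Implicit Defensive.

Import Order.TTheory GRing.Theory Num.Theory.
Import numFieldNormedType.Exports.

Local Open Scope classical_set_scope.
Local Open Scope ring_scope.

Definition frobenius (R : realType) (m n : nat) (A : 'M[R]_(m, n)) : R :=
  Num.sqrt (\sum_i \sum_j A i j ^+ 2).

Definition stiefel (R : realType) (n k : nat) : set 'M[R]_(n, k) :=
  [set V | V^T *m V = 1%:M].

Definition grassmann (R : realType) (n k : nat) : set {vspace 'cV[R]_n} :=
  [set S | \dim S = k].

Definition colspace (R : realType) (n m : nat) (A : 'M[R]_(n, m)) :
    {vspace 'cV[R]_n} :=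
  <<[seq col j A | j : 'I_m]>>%VS.

Definition stiefel_rep (R : realType) (n k : nat) (S : {vspace 'cV[R]_n}) :
    set 'M[R]_(n, k) :=
  [set V | stiefel V /\ colspace V = S].

Definition is_orthproj (R : realType) (n : nat) (S : {vspace 'cV[R]_n})
    (P : 'M[R]_n) : Prop :=
  [/\ P *m P = P, P^T = P & colspace P = S].

(* A triple (U, xi, W) stands for the factorisation A = U diag(xi) W^T.
   The singular values xi are not required to be sorted. *)
Definition thin_svd (R : realType) (n k : nat) (A : 'M[R]_(n, k)) :
    set ('M[R]_(n, k) * 'rV[R]_k * 'M[R]_k) :=
  [set s : 'M[R]_(n, k) * 'rV[R]_k * 'M[R]_k | let: (U, xi, W) := s in
    [/\ U^T *m U = 1%:M, W^T *m W = 1%:M, (forall i, 0 <= xi 0 i)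
      & A = U *m diag_mx xi *m W^T]].

(* A chosen thin SVD. One exists whenever k <= n; the default value is only
   reached when k > n. *)
Definition svd (R : realType) (n k : nat) (A : 'M[R]_(n, k)) :
    'M[R]_(n, k) * 'rV[R]_k * 'M[R]_k :=
  xget (0, 0, 0) (thin_svd A).

(* sigma_j(A) for 1 <= j <= k, the singular values being listed in
   nonincreasing order with multiplicity. *)
Definition singular_value (R : realType) (n k : nat) (A : 'M[R]_(n, k))
    (j : nat) : R :=
  let: (_, xi, _) := svd A in
  nth 0 (sort >=%R [seq xi 0 i | i : 'I_k]) j.-1.

Definition Grlog (R : realType) (n k : nat) (V0 V : 'M[R]_(n, k)) :
    'M[R]_(n, k) :=
  let: (U, xi, W) := svd (V *m invmx (V0^T *m V) - V0) in
  U *m diag_mx (map_mx atan xi) *m W^T.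

Definition Grexp (R : realType) (n k : nat) (V0 Delta : 'M[R]_(n, k)) :
    'M[R]_(n, k) :=
  let: (U, xi, W) := svd Delta in
  V0 *m W *m diag_mx (map_mx cos xi) *m W^T
    + U *m diag_mx (map_mx sin xi) *m W^T.

(* f is the sum of a convergent power series near each point of A. Only the
   values of f on A matter, so at an endpoint of a closed interval this says
   that f extends analytically across it. *)
Definition real_analytic_on (R : realType) (A : set R) (f : R -> R) : Prop :=
  forall t0, A t0 -> exists c : nat -> R, exists2 r : R, 0 < r &
    forall t, A t -> `|t - t0| < r -> pseries c (t - t0) @ \oo --> f t.

(* Derivative relative to A: one-sided at the endpoints when A is a closed
   interval, and independent of the values of f outside A. *)
Definition derive1_within (R : realType) (A : set R) (f : R -> R) (x : R) : R :=
  lim ((f y - f x) / (y - x) @[y --> within A x^']).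

Definition deriven_within_mx (R : realType) (m n : nat) (A : set R) (d : nat)
    (F : R -> 'M[R]_(m, n)) (x : R) : 'M[R]_(m, n) :=
  \matrix_(i, j) iter d (derive1_within A) (fun t => F t i j) x.

Definition cheb_node (R : realType) (N : nat) (i : 'I_N.+1) : R :=
  cos ((2 * i + 1)%:R / (2 * N + 2)%:R * pi).

Definition lagrange_basis (R : realType) (N : nat) (x : 'I_N.+1 -> R)
    (j : 'I_N.+1) (t : R) : R :=
  \prod_(i < N.+1 | i != j) ((t - x i) / (x j - x i)).

Definition lagrange_interp (R : realType) (n k N : nat) (x : 'I_N.+1 -> R)
    (Y : 'I_N.+1 -> 'M[R]_(n, k)) (t : R) : 'M[R]_(n, k) :=
  \sum_(j < N.+1) lagrange_basis x j t *: Y j.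

(* Main.v *)
Require Import Defs.
From HB Require Import structures.
From mathcomp Require Import all_boot all_order all_algebra.
From mathcomp Require spectral.
From mathcomp Require Import all_classical all_reals all_analysis.
From mathcomp Require Import ring lra.
From mathcomp Require Import complex.

Set Implicit Arguments.
Unset Strict Implicit.
Unset Printing Implicit Defensive.

Import Order.TTheory GRing.Theory Num.Theory.
Import numFieldNormedType.Exports.

Local Open Scope classical_set_scope.
Local Open Scope ring_scope.

(** Both sides are projectors onto values of the Grassmann exponential at [V0]: the left one at
    Delta(t), since Exp inverts Log up to the choice of representative, the right one at the
    interpolant. Along s |-> Exp(s Delta) the representative solves the linear equation
    Y' = (Delta V0^T - V0 Delta^T) Y with a skew coefficient, so Delta |-> Exp(Delta) Exp(Delta)^T
    is 4-Lipschitz in the Frobenius norm, and 4 <= 4 (4 C / sigma_min + 1).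

    It remains to bound the interpolation error of Delta. The lift
    L = V (V0^T V)^-1 - V0 = D V0 (V0^T D V0)^-1 - V0 depends only on the projector D, and
    Delta = \int_0^1 L (1 + s^2 L^T L)^-1 ds, so Delta inherits from D derivatives of all orders,
    bounded on [-1, 1]. The remainder formula of Lagrange interpolation then applies, and
    2^N \prod_i (t - t_i) is the Chebyshev polynomial of degree N + 1. *)

(** * Singular value decomposition *)

(** Two choices stand in the way of regularity: the representatives [V t] are picked point by point,
    and [svd] picks singular vectors with no continuity in t. This is why everything is routed
    through the projector and through an integral in which no singular vector occurs. Log and Exp
    each refer to their own chosen SVD. The Lipschitz estimate for Exp is stated for arbitrary SVDs
    of the two tangent vectors, so Exp at Log(V) may be evaluated with the triple (U, atan xi, W)
    inherited from the lift; that another SVD of the same matrix gives the same projector is the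
    case of distance 0. The factor 4 is 2 times 2: the representatives at s = 1 differ by at most
    twice the distance of the tangent vectors, and passing from Y to Y Y^T doubles this once more.
    Smoothness is needed with bounds, not only qualitatively: derivatives are limits within [-1, 1],
    one-sided at the endpoints, and [sup] dominates the norms of the derivative only when these are
    bounded above. *)

Lemma trmxZ (R : realType) m n (a : R) (A : 'M[R]_(m, n)) : (a *: A)^T = a *: A^T.
Proof. by apply/matrixP => i j; rewrite !mxE. Qed.

Lemma trmxB (R : realType) m n (A B : 'M[R]_(m, n)) : (A - B)^T = A^T - B^T.
Proof. by apply/matrixP => i j; rewrite !mxE. Qed.

Lemma trmxM (R : realType) m n p (A : 'M[R]_(m, n)) (B : 'M[R]_(n, p)) :
  (A *m B)^T = B^T *m A^T.
Proof. exact: trmx_mul. Qed.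

Lemma dot_eq0 (R : realType) n (v : 'cV[R]_n) : ((v^T *m v) 0 0 == 0) = (v == 0).
Proof.
rewrite mxE; apply/eqP/eqP => [|->]; last first.
  by apply: big1 => i _; rewrite !mxE mulr0.
move=> /eqP; rewrite psumr_eq0; last by move=> i _; rewrite mxE -expr2 sqr_ge0.
move=> /allP h; apply/matrixP => i j; rewrite ord1 !mxE.
by have := h i (mem_index_enum _); rewrite /= mxE -expr2 sqrf_eq0 => /eqP.
Qed.

Lemma dot_ge0 (R : realType) n (v : 'cV[R]_n) : 0 <= (v^T *m v) 0 0.
Proof. by rewrite mxE; apply: sumr_ge0 => i _; rewrite mxE -expr2 sqr_ge0. Qed.

(** Over the complex numbers an eigenvalue c = a + i b exists. The real and imaginary parts x, y of
    an eigenvector satisfy A x = a x - b y and A y = b x + a y, and symmetry of A gives b (|x|^2 +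
    |y|^2) = 0. Hence b = 0, and whichever of x, y is nonzero is a real eigenvector. *)
Lemma symmetric_eigenvector (R : realType) n (A : 'M[R]_n.+1) : A^T = A ->
  exists (v : 'cV[R]_n.+1) (a : R), v != 0 /\ A *m v = a *: v.
Proof.
move=> symA.
have [c /eigenvalueP[v vB v0]] :=
  @spectral.eigenvalue_closed (complex.complex R) _ (map_mx (complex.real_complex R) A) isT.
pose x : 'cV[R]_n.+1 := \col_i complex.Re (v 0 i).
pose y : 'cV[R]_n.+1 := \col_i complex.Im (v 0 i).
pose a := complex.Re c; pose b := complex.Im c.
have ReM (z : complex.complex R) r : complex.Re (z * complex.real_complex R r) = complex.Re z * r.
  by case: z => z1 z2 /=; rewrite mulr0 subr0.
have ImM (z : complex.complex R) r : complex.Im (z * complex.real_complex R r) = complex.Im z * r.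
  by case: z => z1 z2 /=; rewrite mulr0 add0r.
have Aji i j : A i j = A j i by rewrite -{1}symA mxE.
have Ax : A *m x = a *: x - b *: y.
  apply/matrixP => i j; rewrite !mxE.
  transitivity (complex.Re ((v *m map_mx (complex.real_complex R) A) 0 i)).
    rewrite mxE (big_morph (@complex.Re R) (id1 := 0) (op1 := +%R)) => [|[? ?] [? ?]|] //.
    by apply: eq_bigr => l _; rewrite !mxE ReM mulrC Aji.
  by rewrite vB !mxE /a /b; case: (c) (v 0 i) => ? ? [? ?].
have Ay : A *m y = b *: x + a *: y.
  apply/matrixP => i j; rewrite !mxE.
  transitivity (complex.Im ((v *m map_mx (complex.real_complex R) A) 0 i)).
    rewrite mxE (big_morph (@complex.Im R) (id1 := 0) (op1 := +%R)) => [|[? ?] [? ?]|] //.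
    by apply: eq_bigr => l _; rewrite !mxE ImM mulrC Aji.
  by rewrite vB !mxE /a /b; case: (c) (v 0 i) => ? ? [? ?]; rewrite addrC.
have b0 : b = 0.
  have e : x^T *m (A *m y) = (A *m x)^T *m y by rewrite trmxM symA mulmxA.
  have xy : x^T *m y = y^T *m x.
    by apply/matrixP=> i j; rewrite !ord1 !mxE; apply: eq_bigr => l _; rewrite !mxE mulrC.
  rewrite Ax Ay in e.
  have /matrixP/(_ 0 0) : b *: (x^T *m x + y^T *m y) = 0.
    move: e; rewrite mulmxDr -!scalemxAr linearB /= mulmxBl !linearZ /= -!scalemxAl.
    move=> /matrixP/(_ 0 0); rewrite !mxE => e.
    by apply/matrixP => i j; rewrite !ord1 !mxE; lra.
  rewrite !mxE => /eqP; rewrite mulf_eq0 => /orP[/eqP//|].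
  rewrite paddr_eq0; [|have := dot_ge0 x; by rewrite !mxE|have := dot_ge0 y; by rewrite !mxE].
  have := dot_eq0 x; have := dot_eq0 y; rewrite !mxE => -> -> /andP[/eqP x0 /eqP y0].
  case/eqP: v0; apply/matrixP => i j; rewrite ord1.
  have := congr1 (fun M : 'cV_n.+1 => M j 0) x0; have := congr1 (fun M : 'cV_n.+1 => M j 0) y0.
  by rewrite !mxE; case: (v 0 j) => ? ? /= -> ->.
have [x0|x0] := eqVneq x 0; last by exists x, a; rewrite Ax b0 scale0r subr0.
exists y, a; rewrite Ay b0 scale0r add0r; split => //.
apply: contraNneq v0 => y0; apply/eqP/matrixP => i j; rewrite ord1.
have := congr1 (fun M : 'cV_n.+1 => M j 0) x0; have := congr1 (fun M : 'cV_n.+1 => M j 0) y0.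
by rewrite !mxE; case: (v 0 j) => ? ? /= -> ->.
Qed.

(** The Householder reflection along w = u - e exchanges the unit vectors e and u; the case u = e is
    separate since then w = 0. *)
Lemma orthogonal_with_first_column (R : realType) n (u : 'cV[R]_n.+1) :
  u^T *m u = 1%:M -> exists H : 'M[R]_n.+1, H^T *m H = 1%:M /\ H *m delta_mx 0 0 = u.
Proof.
move=> uu; pose e : 'cV[R]_n.+1 := delta_mx 0 0.
have ee : e^T *m e = 1%:M.
  by rewrite trmx_delta mul_delta_mx; apply/matrixP => i j; rewrite !ord1 !mxE.
have [->|ue] := eqVneq u e; first by exists 1%:M; rewrite trmx1 mulmx1 mul1mx.
pose w := u - e; pose d := (w^T *m w) 0 0.
have d0 : d != 0 by rewrite dot_eq0 subr_eq0.
have ww : w^T *m w = d%:M by rewrite [LHS]mx11_scalar.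
have sym : e^T *m u = u^T *m e.
  by apply/matrixP=> i j; rewrite !ord1 !mxE; apply: eq_bigr => l _; rewrite !mxE mulrC.
have wT : w^T = u^T - e^T by rewrite /w; apply/matrixP => i j; rewrite !mxE.
(* As u and e are unit vectors, d = |u - e|^2 = 2 - 2 u^T e, so w^T e = u^T e - 1 = - d / 2. *)
have we : w^T *m e = (- (d / 2))%:M.
  have : d%:M = 2%:M - 2 *: (u^T *m e).
    rewrite -ww wT /w mulmxBl !mulmxBr uu ee sym.
    by apply/matrixP => i j; rewrite !ord1 !mxE /=; ring.
  move=> /matrixP/(_ 0 0) h; apply/matrixP => i j; rewrite !ord1; move: h.
  rewrite wT mulmxBl ee; move: (u^T *m e) d {d0 ww} => g d.
  by rewrite !mxE /= => h; lra.
pose H := 1%:M - (2 / d) *: (w *m w^T); exists H.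
have HT : H^T = H by rewrite /H linearB linearZ /= trmx1 trmxM trmxK.
split.
  rewrite HT /H mulmxBl mul1mx mulmxBr mulmx1 -!scalemxAl -!scalemxAr scalerA.
  rewrite mulmxA -(mulmxA w) ww mul_mx_scalar -!scalemxAl scalerA.
  have -> : 2 / d * (2 / d) * d = 2 / d + 2 / d by field.
  by move: (w *m w^T) => g; apply/matrixP => i j; rewrite !mxE; ring.
rewrite /H mulmxBl mul1mx -scalemxAl -mulmxA we mul_mx_scalar scalerA.
have -> : 2 / d * - (d / 2) = -1 by field.
by rewrite scaleN1r opprK addrC subrK.
Qed.

Lemma symmetric_unit_eigenvector (R : realType) n (A : 'M[R]_n.+1) : A^T = A ->
  exists (v : 'cV[R]_n.+1) (a : R), v^T *m v = 1%:M /\ A *m v = a *: v.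
Proof.
move=> /symmetric_eigenvector[v [a [v0 Av]]].
have d0 : 0 < (v^T *m v) 0 0 by rewrite lt_neqAle dot_ge0 eq_sym dot_eq0 v0.
pose r := Num.sqrt ((v^T *m v) 0 0).
have r2 : r * r = (v^T *m v) 0 0 by rewrite -expr2 sqr_sqrtr // ltW.
have r0 : r != 0 by apply: contraTneq d0 => r0; rewrite -r2 r0 mul0r ltxx.
exists (r^-1 *: v), a; split; last by rewrite -scalemxAr Av !scalerA mulrC.
rewrite trmxZ -scalemxAl -scalemxAr scalerA [v^T *m v]mx11_scalar -r2.
rewrite scale_scalar_mx; congr (_%:M); field.
exact: r0.
Qed.

(** Take v a unit eigenvector of A^T A, s = |A v| and u = A v / s. If A v = 0, then s = 0 and u has
    to come from the left kernel: A is not injective, so its rank is at most k, which is less than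
    the number m + 1 of rows. *)
Lemma singular_pair (R : realType) m k (A : 'M[R]_(m.+1, k.+1)) : (k <= m)%N ->
  exists (u : 'cV[R]_m.+1) (v : 'cV[R]_k.+1) (s : R),
  [/\ u^T *m u = 1%:M, v^T *m v = 1%:M, 0 <= s, A *m v = s *: u & u^T *m A = s *: v^T].
Proof.
move=> km.
have [v [a [vv Av]]] : exists (v : 'cV[R]_k.+1) (a : R),
    v^T *m v = 1%:M /\ (A^T *m A) *m v = a *: v.
  by apply: symmetric_unit_eigenvector; rewrite trmxM trmxK.
have Av' : A^T *m (A *m v) = a *: v by rewrite mulmxA; exact: Av.
have [Av0|Av0] := eqVneq (A *m v) 0.
  have [u u0 uA] : exists2 u : 'rV[R]_m.+1, u != 0 & u *m A = 0.
    suff /rowV0Pn[u /sub_kermxP uA u0] : kermx A != 0 by exists u.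
    rewrite kermx_eq0 /row_free neq_ltn.
    apply/orP; left; apply: (@leq_ltn_trans k); last by rewrite ltnS.
    rewrite -ltnS ltn_neqAle rank_leq_col andbT; apply/negP => fullA.
    have vA : v^T *m A^T = 0 by rewrite -trmxM Av0 trmx0.
    have /row_free_inj inj : row_free A^T by rewrite /row_free mxrank_tr.
    have /matrixP v0 : v^T = 0 by apply: inj; rewrite vA mul0mx.
    have /matrixP/(_ 0 0) := vv; rewrite [v^T](_ : _ = 0) ?mul0mx; last exact/matrixP.
    by rewrite !mxE => /eqP; rewrite eq_sym oner_eq0.
  have ut0 : (u *m u^T) 0 0 != 0 by rewrite -{1}[u]trmxK dot_eq0 trmx_eq0.
  have ut : 0 < (u *m u^T) 0 0 by rewrite lt_neqAle eq_sym ut0 -{1}[u]trmxK dot_ge0.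
  pose r := Num.sqrt ((u *m u^T) 0 0).
  have r2 : r * r = (u *m u^T) 0 0 by rewrite -expr2 sqr_sqrtr // ltW.
  have r0 : r != 0 by apply: contraTneq ut => r0; rewrite -r2 r0 mul0r ltxx.
  exists (r^-1 *: u^T), v, 0; split => //; rewrite ?scale0r //.
    rewrite trmxZ trmxK -scalemxAl -scalemxAr scalerA [u *m _]mx11_scalar -r2.
    by rewrite scale_scalar_mx; congr (_%:M); field; exact: r0.
  by rewrite trmxZ trmxK -scalemxAl uA scaler0.
have dAv : 0 < ((A *m v)^T *m (A *m v)) 0 0.
  by rewrite lt_neqAle dot_ge0 eq_sym dot_eq0 Av0.
pose s := Num.sqrt (((A *m v)^T *m (A *m v)) 0 0).
have s2 : s * s = ((A *m v)^T *m (A *m v)) 0 0 by rewrite -expr2 sqr_sqrtr // ltW.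
have s0 : s != 0 by apply: contraTneq dAv => s0; rewrite -s2 s0 mul0r ltxx.
have as2 : a = s * s.
  rewrite s2 trmxM -mulmxA Av' -scalemxAr vv.
  by rewrite !mxE /= mulr1.
exists (s^-1 *: (A *m v)), v, s; split => //.
- rewrite trmxZ -scalemxAl -scalemxAr scalerA [_ *m (A *m v)]mx11_scalar -s2.
  by rewrite scale_scalar_mx; congr (_%:M); field; exact: s0.
- exact: sqrtr_ge0.
- by rewrite scalerA mulfV // scale1r.
rewrite trmxZ trmxM -scalemxAl -mulmxA.
have -> : v^T *m (A^T *m A) = a *: v^T.
  by apply: trmx_inj; rewrite trmxZ !trmxM !trmxK -mulmxA Av'.
by rewrite scalerA as2; congr (_ *: _); field; exact: s0.
Qed.

(** Orthogonal P and Q with first columns u and v turn A into P^T A Q, whose first row and column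
    vanish off the corner entry s. The induction hypothesis applies to the remaining block, and the
    factors are reassembled blockwise; no ordering of the singular values has to be maintained. *)
Lemma thin_svd_exists (R : realType) (n k : nat) (A : 'M[R]_(n, k)) :
  (k <= n)%N -> exists s, thin_svd A s.
Proof.
elim: k n A => [|k IH] [|m] // A km.
- by exists (0, 0, 0); split; try (by case); apply/matrixP => ? [].
- by exists (0, 0, 0); split; try (by case); apply/matrixP => ? [].
have [u [v [s [uu vv s0 Av uA]]]] := singular_pair A km.
have [P [PP Pu]] := orthogonal_with_first_column uu.
have [Q [QQ Qv]] := orthogonal_with_first_column vv.
have PP' : P *m P^T = 1%:M by apply: mulmx1C.
have QQ' : Q *m Q^T = 1%:M by apply: mulmx1C.
have PTu : P^T *m u = delta_mx 0 0 by rewrite -Pu mulmxA PP mul1mx.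
have QTv : v^T *m Q = delta_mx 0 0 by rewrite -Qv trmxM -mulmxA QQ mulmx1 trmx_delta.
pose B := P^T *m A *m Q.
have AB : A = P *m B *m Q^T.
  by rewrite /B !mulmxA PP' mul1mx -mulmxA QQ' mulmx1.
have B0 i : B i 0 = s * (i == 0)%:R.
  have : B *m delta_mx 0 0 = s *: (delta_mx 0 0 : 'M[R]_(m.+1, 1)).
    by rewrite /B -mulmxA Qv -mulmxA Av -scalemxAr PTu.
  by move/matrixP/(_ i 0); rewrite -colE [LHS]mxE => ->; rewrite !mxE andbT.
have B1 j : B 0 j = s * (j == 0)%:R.
  have : delta_mx 0 0 *m B = s *: (delta_mx 0 0 : 'M[R]_(1, k.+1)).
    have -> : delta_mx 0 0 = u^T *m P by rewrite -Pu trmxM -mulmxA PP mulmx1 trmx_delta.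
    by rewrite /B !mulmxA -(mulmxA _ P) PP' mulmx1 uA -scalemxAl QTv.
  by move/matrixP/(_ 0 j); rewrite -rowE [LHS]mxE => ->; rewrite !mxE.
move: B AB B0 B1 => B AB B0 B1.
have [[[U xi] W] [UU WW xi0 Bsvd]] := IH m (drsubmx (B : 'M[R]_(1 + m, 1 + k))) km.
pose U' : 'M[R]_(1 + m, 1 + k) := block_mx 1%:M 0 0 U.
pose W' : 'M[R]_(1 + k, 1 + k) := block_mx 1%:M 0 0 W.
pose xi' : 'rV[R]_(1 + k) := row_mx s%:M xi.
have Be : B = block_mx (s%:M : 'M[R]_(1, 1)) 0 0 (drsubmx (B : 'M[R]_(1 + m, 1 + k)))
    :> 'M[R]_(1 + m, 1 + k).
  rewrite -[LHS](@submxK _ 1 m 1 k); congr block_mx.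
  - by apply/matrixP => i j; rewrite !ord1 !mxE; have := B0 0; rewrite mulr1 /= => <-;
      congr (B _ _); apply/val_inj.
  - apply/matrixP => i j; rewrite !ord1 !mxE.
    have := B1 (rshift 1 j); rewrite mulr0 => <-.
    by congr (B _ _); apply/val_inj.
  - apply/matrixP => i j; rewrite !ord1 !mxE.
    have := B0 (rshift 1 i); rewrite mulr0 => <-.
    by congr (B _ _); apply/val_inj.
have U'U' : U'^T *m U' = 1%:M.
  rewrite /U' tr_block_mx mulmx_block !trmx0 !trmx1 !mulmx0 !mul0mx !addr0 !add0r.
  by rewrite mulmx1 UU -scalar_mx_block.
have W'W' : W'^T *m W' = 1%:M.
  rewrite /W' tr_block_mx mulmx_block !trmx0 !trmx1 !mulmx0 !mul0mx !addr0 !add0r.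
  by rewrite mulmx1 WW -scalar_mx_block.
exists (P *m U', xi', Q *m W'); split.
- by rewrite trmxM mulmxA -(mulmxA _ P^T) PP mulmx1.
- by rewrite trmxM mulmxA -(mulmxA _ Q^T) QQ mulmx1.
- by move=> i; rewrite /xi' mxE; case: fintype.split => j //; rewrite ord1 mxE.
rewrite AB trmxM !mulmxA; congr (_ *m _); rewrite -!mulmxA; congr (_ *m _).
transitivity (U' *m (@diag_mx R (1 + k) xi' *m W'^T)); last by [].
rewrite Be Bsvd /U' /W' /xi' diag_mx_row tr_block_mx !mulmx_block.
rewrite !trmx0 !trmx1 !mulmx0 !mul0mx !addr0 !add0r !mulmx1 !mul1mx mulmxA.
rewrite mulmx0; congr (@block_mx _ 1 m 1 k _ _ _ _).
by apply/matrixP => i j; rewrite !ord1 !mxE.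
Qed.

Lemma svdP (R : realType) (n k : nat) (A : 'M[R]_(n, k)) :
  (k <= n)%N -> thin_svd A (svd A).
Proof. by move=> kn; apply: xgetPex; exact: thin_svd_exists. Qed.

(** * Lipschitz continuity of the exponential *)

Lemma trace_trmulE (R : realType) m n (A B : 'M[R]_(m, n)) :
  \tr (A^T *m B) = \sum_i \sum_j A i j * B i j.
Proof.
rewrite /mxtrace exchange_big /=; apply: eq_bigr => j _; rewrite mxE.
by apply: eq_bigr => i _; rewrite !mxE.
Qed.

Lemma sqr_frobenius (R : realType) m n (A : 'M[R]_(m, n)) :
  frobenius A ^+ 2 = \tr (A^T *m A).
Proof.
rewrite trace_trmulE sqr_sqrtr; first by [].
by apply: sumr_ge0 => i _; apply: sumr_ge0 => j _; exact: sqr_ge0.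
Qed.

Lemma frobenius_ge0 (R : realType) m n (A : 'M[R]_(m, n)) : 0 <= frobenius A.
Proof. exact: sqrtr_ge0. Qed.

Lemma tr_gram_ge0 (R : realType) m n (A : 'M[R]_(m, n)) : 0 <= \tr (A^T *m A).
Proof. by rewrite -sqr_frobenius sqr_ge0. Qed.

Lemma frobenius_eq0 (R : realType) m n (A : 'M[R]_(m, n)) :
  (frobenius A == 0) = (A == 0).
Proof.
apply/eqP/eqP => [A0|->]; last first.
  by rewrite /frobenius big1 ?sqrtr0 // => i _; rewrite big1 // => j _; rewrite mxE expr0n.
have := sqr_frobenius A; rewrite A0 expr0n trace_trmulE => /esym/eqP.
rewrite psumr_eq0 => [/allP h|i _]; last by apply: sumr_ge0 => j _; rewrite -expr2 sqr_ge0.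
apply/matrixP => i j; rewrite mxE; have := h i (mem_index_enum _).
rewrite /= psumr_eq0 => [/allP/(_ j (mem_index_enum _))/=|l _]; last by rewrite -expr2 sqr_ge0.
by rewrite -expr2 sqrf_eq0 => /eqP.
Qed.

Lemma trace_trmulC (R : realType) m n (A B : 'M[R]_(m, n)) :
  \tr (A^T *m B) = \tr (B^T *m A).
Proof.
by rewrite !trace_trmulE; apply: eq_bigr => i _; apply: eq_bigr => j _; rewrite mulrC.
Qed.

Lemma trace_gramD (R : realType) m n (A B : 'M[R]_(m, n)) :
  \tr ((A + B)^T *m (A + B)) = \tr (A^T *m A) + \tr (A^T *m B) *+ 2 + \tr (B^T *m B).
Proof.
rewrite !trace_trmulE -sumrMnl -!big_split; apply: eq_bigr => i _ /=.
rewrite -sumrMnl -!big_split; apply: eq_bigr => j _ /=.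
by rewrite !mxE mulr2n; ring.
Qed.

Lemma trace_gramZ (R : realType) m n (a : R) (A : 'M[R]_(m, n)) :
  \tr ((a *: A)^T *m (a *: A)) = a ^+ 2 * \tr (A^T *m A).
Proof.
rewrite !trace_trmulE mulr_sumr; apply: eq_bigr => i _.
by rewrite mulr_sumr; apply: eq_bigr => j _; rewrite !mxE; ring.
Qed.

(** Expand the squared norm of |B| A - |A| B, which is nonnegative, and divide by |A| |B|. *)
Lemma frobenius_CS (R : realType) m n (A B : 'M[R]_(m, n)) :
  \tr (A^T *m B) <= frobenius A * frobenius B.
Proof.
have [->|A0] := eqVneq A 0.
  by rewrite trmx0 mul0mx mxtrace0 mulr_ge0 ?frobenius_ge0.
have [->|B0] := eqVneq B 0.
  by rewrite mulmx0 mxtrace0 mulr_ge0 ?frobenius_ge0.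
have a0 : 0 < frobenius A by rewrite lt_neqAle frobenius_ge0 eq_sym frobenius_eq0 A0.
have b0 : 0 < frobenius B by rewrite lt_neqAle frobenius_ge0 eq_sym frobenius_eq0 B0.
have := tr_gram_ge0 (frobenius B *: A + (- frobenius A) *: B).
rewrite trace_gramD !trace_gramZ -!sqr_frobenius trmxZ -scalemxAl -scalemxAr !mxtraceZ.
move: (\tr _) (frobenius A) (frobenius B) a0 b0 => t a b a0 b0 h.
rewrite -(ler_pM2l (mulr_gt0 a0 b0)); move: h; rewrite mulr2n sqrrN.
by nra.
Qed.

Lemma frobenius_triangle (R : realType) m n (A B : 'M[R]_(m, n)) :
  frobenius (A + B) <= frobenius A + frobenius B.
Proof.
rewrite -(@ler_pXn2r _ 2) ?nnegrE ?addr_ge0 ?frobenius_ge0 //.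
rewrite sqr_frobenius trace_gramD -!sqr_frobenius.
by have := frobenius_CS A B; rewrite sqrrD mulr2n; lra.
Qed.

Lemma frobenius_trmx (R : realType) m n (A : 'M[R]_(m, n)) : frobenius A^T = frobenius A.
Proof.
congr Num.sqrt; rewrite exchange_big /=.
by apply: eq_bigr => i _; apply: eq_bigr => j _; rewrite mxE.
Qed.

Lemma frobenius_mul_isometry (R : realType) n k m (Y : 'M[R]_(n, k)) (Z : 'M[R]_(k, m)) :
  Y^T *m Y = 1%:M -> frobenius (Y *m Z) = frobenius Z.
Proof.
move=> YY; apply/eqP; rewrite -(@eqrXn2 _ 2) ?frobenius_ge0 //.
by rewrite !sqr_frobenius trmxM mulmxA -(mulmxA Z^T) YY mulmx1.
Qed.

(** Pythagoras: the difference of the two sides is the squared norm of A (1 - Y Y^T). *)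
Lemma trace_gram_mul_stiefel (R : realType) n k m (A : 'M[R]_(m, n)) (Y : 'M[R]_(n, k)) :
  Y^T *m Y = 1%:M -> \tr ((A *m Y)^T *m (A *m Y)) <= \tr (A^T *m A).
Proof.
move=> YY; rewrite -subr_ge0.
have := tr_gram_ge0 (A - A *m Y *m Y^T)^T; rewrite trmxK.
rewrite trmxB !trmxM trmxK mulmxBl !mulmxBr.
have -> : A *m Y *m Y^T *m (Y *m (Y^T *m A^T)) = A *m Y *m (Y^T *m A^T).
  by rewrite !mulmxA -(mulmxA _ Y^T Y) YY mulmx1.
rewrite -[A *m Y *m Y^T *m A^T]mulmxA subrr subr0 linearB /=.
rewrite [\tr (A^T *m A)]mxtrace_mulC [\tr (_ *m (A *m Y))]mxtrace_mulC.
by rewrite !mulmxA.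
Qed.

Lemma skew_quadratic_form (R : realType) n k (O : 'M[R]_n) (Z : 'M[R]_(n, k)) :
  O^T = - O -> \tr (Z^T *m (O *m Z)) = 0.
Proof.
move=> skew; have : \tr (Z^T *m (O *m Z)) = - \tr (Z^T *m (O *m Z)).
  by rewrite {1}trace_trmulC trmxM skew mulmxN mulNmx linearN /= mulmxA.
by move=> h; apply/eqP; rewrite -[_ == 0](mulrn_eq0 _ 2) mulr2n {1}h addNr.
Qed.

Lemma sub_mxE (R : zmodType) m n (A B : 'M[R]_(m, n)) i j : (A - B) i j = A i j - B i j.
Proof. by rewrite !mxE. Qed.

(* With f(s) = |Y1 s - Y2 s|^2 and c = |O1 - O2|, skewness gives
   f' <= 2 c sqrt f <= f / (s + 1) + c^2 (s + 1), so f / (s + 1) grows at rate at most c^2. *)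
Lemma skew_flow_distance (R : realType) n k (O1 O2 : 'M[R]_n) (Y1 Y2 : R -> 'M[R]_(n, k)) :
  O1^T = - O1 ->
  (forall s, (Y2 s)^T *m Y2 s = 1%:M) ->
  (forall s i j, is_derive s (1 : R) (fun s => Y1 s i j) ((O1 *m Y1 s) i j)) ->
  (forall s i j, is_derive s (1 : R) (fun s => Y2 s i j) ((O2 *m Y2 s) i j)) ->
  Y1 0 = Y2 0 ->
  frobenius (Y1 1 - Y2 1) ^+ 2 <= 2 * frobenius (O1 - O2) ^+ 2.
Proof.
move=> skew YY2 dY1 dY2 Y0.
(* This way of writing O1 Y1 - O2 Y2 leaves a skew term in Z, which drops out of the derivative of
   |Z|^2, and a term in which O1 - O2 meets only [Y2], whose columns are orthonormal. *)
pose Z s := Y1 s - Y2 s; pose dZ s := O1 *m Z s + (O1 - O2) *m Y2 s.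
pose f s := \tr ((Z s)^T *m Z s).
have dZij s i j : is_derive s (1 : R) (fun s => Z s i j) (dZ s i j).
  have -> : dZ s = O1 *m Y1 s - O2 *m Y2 s.
    by rewrite /dZ /Z mulmxBr mulmxBl addrA subrK.
  have -> : (fun s => Z s i j) = (fun s => Y1 s i j) - (fun s => Y2 s i j).
    by apply/funext => r; rewrite /Z !mxE.
  by rewrite sub_mxE; apply: is_deriveB.
have df s : is_derive s (1 : R) f (2 * \tr ((Z s)^T *m dZ s)).
  have -> : f = \sum_i \sum_j ((fun s => Z s i j) * (fun s => Z s i j)).
    apply/funext => r; rewrite /f trace_trmulE fct_sumE; apply: eq_bigr => i _.
    by rewrite fct_sumE.
  rewrite trace_trmulE mulr_sumr; apply: is_derive_sum => i.
  rewrite mulr_sumr; apply: is_derive_sum => j.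
  have := is_deriveM (dZij s i j) (dZij s i j).
  by rewrite /GRing.scale /= => h; apply: (is_derive_eq h); ring.
have trdZ s : \tr ((Z s)^T *m dZ s) = \tr ((Z s)^T *m ((O1 - O2) *m Y2 s)).
  by rewrite /dZ mulmxDr mxtraceD skew_quadratic_form // add0r.
set c := frobenius (O1 - O2) ^+ 2.
have EY s : \tr (((O1 - O2) *m Y2 s)^T *m ((O1 - O2) *m Y2 s)) <= c.
  by rewrite /c sqr_frobenius; apply: trace_gram_mul_stiefel.
pose q s := f s * (s + 1)^-1.
pose dq (s : R) : R := f s * (- (s + 1) ^- 2) + (s + 1)^-1 * (2 * \tr ((Z s)^T *m dZ s)).
have dqE (s : R) : 0 <= s -> is_derive s (1 : R) q (dq s).
  move=> s0; have s1 : s + 1 != 0 by rewrite gt_eqF // ltr_wpDl.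
  have di : is_derive s (1 : R) (fun s : R => (s + 1)^-1) (- (s + 1) ^- 2).
    have dl : is_derive s (1 : R) (fun s : R => s + 1) 1.
      by apply: is_derive_eq; rewrite addr0.
    have := @is_deriveV _ (fun s : R => s + 1) s 1 1 s1 dl.
    by move=> h; apply: (is_derive_eq h); rewrite /GRing.scale /= mulr1.
  exact: is_deriveM.
have dq_le (s : R) : 0 <= s -> dq s <= c.
  move=> s0; have s1 : 0 < s + 1 by rewrite ltr_wpDl.
  rewrite /dq trdZ.
  (* The weighted inequality 2 (s + 1) b <= a + (s + 1)^2 d, with a = |Z|^2, d = |(O1 - O2) Y2|^2 <=
     c and b the inner product of the two matrices. *)
  have h := tr_gram_ge0 (Z s + (- (s + 1)) *: ((O1 - O2) *m Y2 s)).
  rewrite trace_gramD trace_gramZ -scalemxAr mxtraceZ in h.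
  have {}EY := EY s; rewrite /f.
  move: (\tr _) (\tr _) (\tr _) EY h => b a d EY h.
  have -> : a * - (s + 1) ^- 2 + (s + 1)^-1 * (2 * b) =
            (2 * (s + 1) * b - a) / (s + 1) ^+ 2.
    by field; rewrite gt_eqF.
  rewrite ler_pdivrMr ?exprn_gt0 // mulrC.
  have := ler_wpM2l (sqr_ge0 (s + 1)) EY.
  by move: h; rewrite mulr2n; nra.
have q0 : q 0 = 0.
  by rewrite /q /f /Z Y0 subrr mulmx0 mxtrace0 mul0r.
have [x x01 e] : exists2 x, x \in `]0, 1[%R & q 1 - q 0 = dq x * (1 - 0).
  apply: MVT => // [x|].
    by rewrite in_itv /= => /andP[x0 _]; apply: dqE; exact: ltW.
  apply/continuous_within_itvP => //; split.
  - move=> x; rewrite in_itv /= => /andP[x0 _]; apply: differentiable_continuous.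
    by apply/derivable1_diffP; have [] := dqE x (ltW x0).
  - apply: cvg_at_right_filter; apply: differentiable_continuous.
    by apply/derivable1_diffP; have [] := dqE 0 (lexx _).
  - apply: cvg_at_left_filter; apply: differentiable_continuous.
    by apply/derivable1_diffP; have [] := dqE 1 ler01.
rewrite q0 !subr0 mulr1 in e.
move: x01; rewrite in_itv /= => /andP[x0 _]; have := dq_le x (ltW x0).
(* At s = 1 the weight s + 1 equals 2, which is the factor in the bound. *)
have -> : frobenius (Y1 1 - Y2 1) ^+ 2 = f 1 by rewrite sqr_frobenius.
by rewrite -e /q ler_pdivrMr ?ltr0n ?addr_gt0 // mulrC (_ : 1 + 1 = 2).
Qed.

(** * The curves s |-> Exp(s Delta) *)

Lemma add_mxE (R : nmodType) m n (A B : 'M[R]_(m, n)) i j : (A + B) i j = A i j + B i j.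
Proof. by rewrite !mxE. Qed.

(** In an SVD of a tangent vector only the columns of U with nonzero singular value are known to be
    orthogonal to V0. So V0^T U need not vanish, but V0^T U g(xi) does as soon as g vanishes at 0;
    this is used for the sine and the arctangent. *)
Lemma diag_mx_ext0 (R : realType) m k (M : 'M[R]_(m, k)) (x y : 'rV[R]_k) :
  (forall j, x 0 j = 0 -> y 0 j = 0) -> M *m diag_mx x = 0 -> M *m diag_mx y = 0.
Proof.
move=> xy /matrixP M0; apply/matrixP => i j; have := M0 i j.
rewrite !mul_mx_diag !mxE => /eqP; rewrite mulf_eq0 => /orP[/eqP ->|/eqP/xy ->].
  by rewrite mul0r.
by rewrite mulr0.
Qed.

(** The argument is an SVD triple rather than a tangent vector, so that statements about the curve
    hold for every SVD and not only for the one selected by [svd]. *)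
Definition exp_curve (R : realType) n k (V0 : 'M[R]_(n, k))
    (s : 'M[R]_(n, k) * 'rV[R]_k * 'M[R]_k) (r : R) : 'M[R]_(n, k) :=
  let: (U, xi, W) := s in
  V0 *m W *m diag_mx (map_mx cos (r *: xi)) *m W^T
    + U *m diag_mx (map_mx sin (r *: xi)) *m W^T.

Lemma exp_curve0 (R : realType) n k (V0 Delta : 'M[R]_(n, k)) s :
  thin_svd Delta s -> exp_curve V0 s 0 = V0.
Proof.
case: s => [[U xi] W] [_ WW _ _]; rewrite /exp_curve scale0r.
have -> : map_mx cos 0 = const_mx 1 :> 'rV[R]_k.
  by apply/matrixP => i j; rewrite !mxE cos0.
have -> : map_mx sin 0 = 0 :> 'rV[R]_k.
  by apply/matrixP => i j; rewrite !mxE sin0.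
have -> : diag_mx (0 : 'rV[R]_k) = 0.
  by apply/matrixP => i j; rewrite !mxE mul0rn.
rewrite diag_const_mx mulmx1 mulmx0 mul0mx addr0 -mulmxA.
by rewrite (mulmx1C WW) mulmx1.
Qed.

Lemma orth_sin0 (R : realType) n k (V0 Delta U : 'M[R]_(n, k)) xi W (r : R) :
  V0^T *m Delta = 0 -> thin_svd Delta (U, xi, W) ->
  V0^T *m U *m diag_mx (map_mx sin (r *: xi)) = 0.
Proof.
move=> V0D [_ WW _ De]; apply: (@diag_mx_ext0 _ _ _ _ xi).
  by move=> j; rewrite !mxE => ->; rewrite mulr0 sin0.
have e : V0^T *m U *m diag_mx xi *m W^T = 0 by rewrite -!mulmxA (mulmxA U) -De.
by rewrite -[LHS]mulmx1 -WW mulmxA e mul0mx.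
Qed.

Lemma diag_cos2_sin2 (R : realType) k (x : 'rV[R]_k) :
  diag_mx (map_mx cos x) *m diag_mx (map_mx cos x) +
  diag_mx (map_mx sin x) *m diag_mx (map_mx sin x) = 1%:M.
Proof.
apply/matrixP => i j; rewrite !mulmx_diag !mxE -mulrnDl -!expr2.
by rewrite cos2Dsin2.
Qed.

(** Up to the orthogonal factor W^T the curve is V0 W C + U S with C, S the diagonal cosine and
    sine. Its mixed products vanish by tangency, so its Gram matrix is C^2 + S^2 = 1. *)
Lemma exp_curve_stiefel (R : realType) n k (V0 Delta : 'M[R]_(n, k)) s (r : R) :
  V0^T *m V0 = 1%:M -> V0^T *m Delta = 0 -> thin_svd Delta s ->
  (exp_curve V0 s r)^T *m exp_curve V0 s r = 1%:M.
Proof.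
case: s => [[U xi] W] V0V0 V0D svdD; have [UU WW _ De] := svdD.
rewrite /exp_curve; have S0 := orth_sin0 r V0D svdD.
set C := diag_mx (map_mx cos _); set S := diag_mx (map_mx sin _) in S0 *.
have CT : C^T = C by rewrite tr_diag_mx.
have ST : S^T = S by rewrite tr_diag_mx.
have S0' : S *m U^T *m V0 = 0.
  by apply: trmx_inj; rewrite trmx0 -S0 !trmxM trmxK ST mulmxA.
rewrite -mulmxDl trmxM trmxK -mulmxA (mulmxA _^T).
suff -> : (V0 *m W *m C + U *m S)^T *m (V0 *m W *m C + U *m S) = 1%:M.
  by rewrite mul1mx (mulmx1C WW).
rewrite [(_ + _)^T]linearD /= mulmxDl !mulmxDr !trmxM CT ST.
have -> : C *m (W^T *m V0^T) *m (V0 *m W *m C) = C *m C.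
  by rewrite -!mulmxA (mulmxA V0^T V0) V0V0 mul1mx (mulmxA W^T W) WW mul1mx.
have -> : C *m (W^T *m V0^T) *m (U *m S) = 0.
  by rewrite -!mulmxA (mulmxA V0^T U) S0 !mulmx0.
have -> : S *m U^T *m (V0 *m W *m C) = 0.
  by rewrite !mulmxA S0' !mul0mx.
have -> : S *m U^T *m (U *m S) = S *m S.
  by rewrite -mulmxA (mulmxA U^T U) UU mul1mx.
by rewrite addr0 add0r diag_cos2_sin2.
Qed.

Lemma is_derive_cos_scale (R : realType) (x r : R) :
  is_derive r (1 : R) (fun r => cos (r * x)) (- (x * sin (r * x))).
Proof.
have h : is_derive r (1 : R) (fun r => r * x) x.
  by apply: is_derive_eq; rewrite scaler0 add0r /GRing.scale /= mulr1.
by have h1 := is_derive1_comp (is_derive_cos _) h; apply: (is_derive_eq h1); ring.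
Qed.

Lemma is_derive_sin_scale (R : realType) (x r : R) :
  is_derive r (1 : R) (fun r => sin (r * x)) (x * cos (r * x)).
Proof.
have h : is_derive r (1 : R) (fun r => r * x) x.
  by apply: is_derive_eq; rewrite scaler0 add0r /GRing.scale /= mulr1.
by have h1 := is_derive1_comp (is_derive_sin _) h; apply: (is_derive_eq h1); ring.
Qed.

Lemma is_derive_diag_sandwich (R : realType) n k (A : 'M[R]_(n, k)) (B : 'M[R]_k)
    (x : R -> 'rV[R]_k) (dx : 'rV[R]_k) (r : R) :
  (forall j, is_derive r (1 : R) (fun r => x r 0 j) (dx 0 j)) ->
  forall i j, is_derive r (1 : R) (fun r => (A *m diag_mx (x r) *m B) i j)
    ((A *m diag_mx dx *m B) i j).
Proof.
move=> dxE i j.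
have E y : (A *m diag_mx y *m B) i j = \sum_l A i l * B l j * y 0 l.
  by rewrite mxE; apply: eq_bigr => l _; rewrite mul_mx_diag mxE mulrAC.
have -> : (fun r => (A *m diag_mx (x r) *m B) i j) =
    \sum_l (A i l * B l j \*: (fun r => x r 0 l)).
  by apply/funext => s; rewrite E fct_sumE.
by rewrite E; apply: is_derive_sum => l; apply: is_deriveZ.
Qed.

(** The coefficient rotates the two summands into each other: Delta V0^T sends the cosine part to U
    xi C W^T, the derivative of the sine part, and - V0 Delta^T sends the sine part to - V0 W xi S
    W^T, the derivative of the cosine part. The two remaining products vanish by tangency. *)
Lemma is_derive_exp_curve (R : realType) n k (V0 Delta : 'M[R]_(n, k)) s (r : R) :
  V0^T *m V0 = 1%:M -> V0^T *m Delta = 0 -> thin_svd Delta s ->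
  forall i j, is_derive r (1 : R) (fun r => exp_curve V0 s r i j)
    (((Delta *m V0^T - V0 *m Delta^T) *m exp_curve V0 s r) i j).
Proof.
case: s => [[U xi] W] V0V0 V0D svdD i j; have [UU WW _ De] := svdD.
have S0 := orth_sin0 r V0D svdD.
pose dc : 'rV[R]_k := \row_j (- (xi 0 j * sin (r * xi 0 j))).
pose ds : 'rV[R]_k := \row_j (xi 0 j * cos (r * xi 0 j)).
have h1 : is_derive r (1 : R)
   (fun r => (V0 *m W *m diag_mx (map_mx cos (r *: xi)) *m W^T) i j)
   ((V0 *m W *m diag_mx dc *m W^T) i j).
  apply: is_derive_diag_sandwich => l; rewrite !mxE.
  rewrite (_ : (fun r => _) = (fun r => cos (r * xi 0 l))).
    exact: is_derive_cos_scale.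
  by apply/funext => t; rewrite !mxE.
have h2 : is_derive r (1 : R)
   (fun r => (U *m diag_mx (map_mx sin (r *: xi)) *m W^T) i j)
   ((U *m diag_mx ds *m W^T) i j).
  apply: is_derive_diag_sandwich => l; rewrite !mxE.
  rewrite (_ : (fun r => _) = (fun r => sin (r * xi 0 l))).
    exact: is_derive_sin_scale.
  by apply/funext => t; rewrite !mxE.
have -> : (Delta *m V0^T - V0 *m Delta^T) *m exp_curve V0 (U, xi, W) r =
    V0 *m W *m diag_mx dc *m W^T + U *m diag_mx ds *m W^T.
  rewrite /exp_curve; set C := diag_mx (map_mx cos _).
  set S := diag_mx (map_mx sin _) in S0 *.
  rewrite mulmxBl !mulmxDr.
  have DTV0 : Delta^T *m V0 = 0 by apply: trmx_inj; rewrite trmxM trmxK trmx0.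
  have -> : Delta *m V0^T *m (V0 *m W *m C *m W^T) = U *m diag_mx ds *m W^T.
    rewrite -!mulmxA (mulmxA V0^T V0) V0V0 mul1mx De -!mulmxA (mulmxA W^T W) WW mul1mx.
    congr (_ *m _); rewrite !mulmxA mulmx_diag; congr (diag_mx _ *m _).
    by apply/matrixP => a b; rewrite !mxE.
  have -> : Delta *m V0^T *m (U *m S *m W^T) = 0.
    by rewrite -!mulmxA (mulmxA U) (mulmxA V0^T) (mulmxA V0^T) S0 mul0mx mulmx0.
  have -> : V0 *m Delta^T *m (V0 *m W *m C *m W^T) = 0.
    by rewrite -!mulmxA (mulmxA Delta^T V0) DTV0 mul0mx mulmx0.
  have -> : V0 *m Delta^T *m (U *m S *m W^T) = - (V0 *m W *m diag_mx dc *m W^T).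
    rewrite De !trmxM trmxK tr_diag_mx -!mulmxA (mulmxA U^T U) UU mul1mx.
    rewrite -!mulmxN; congr (_ *m (_ *m _)); rewrite mulmxN -mulNmx !mulmxA mulmx_diag.
    congr (_ *m _); apply/matrixP => a b; rewrite !mxE -mulNrn; congr (_ *+ _).
    by rewrite opprK.
  by rewrite addr0 add0r opprK addrC.
rewrite (_ : (fun r => _) =
   (fun r => (V0 *m W *m diag_mx (map_mx cos (r *: xi)) *m W^T) i j) +
   (fun r => (U *m diag_mx (map_mx sin (r *: xi)) *m W^T) i j)); last first.
  by apply/funext => t; rewrite /exp_curve [LHS]mxE.
by rewrite add_mxE; exact: (is_deriveD h1 h2).
Qed.

(** With E = D1 - D2, the blocks E V0^T and V0 E^T are orthogonal and each has norm |E|, so the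
    squared distance of the skew coefficients is 2 |E|^2. [skew_flow_distance] contributes another
    factor 2, hence |Y1 - Y2| <= 2 |E|, and Y1 Y1^T - Y2 Y2^T splits into two terms of norm |Y1 -
    Y2|. *)
Lemma exp_projector_lipschitz (R : realType) n k (V0 D1 D2 : 'M[R]_(n, k)) s1 s2 :
  V0^T *m V0 = 1%:M -> V0^T *m D1 = 0 -> V0^T *m D2 = 0 ->
  thin_svd D1 s1 -> thin_svd D2 s2 ->
  frobenius (exp_curve V0 s1 1 *m (exp_curve V0 s1 1)^T -
             exp_curve V0 s2 1 *m (exp_curve V0 s2 1)^T) <= 4 * frobenius (D1 - D2).
Proof.
move=> V0V0 V0D1 V0D2 svd1 svd2.
pose O (D : 'M[R]_(n, k)) := D *m V0^T - V0 *m D^T.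
have skewO D : (O D)^T = - O D by rewrite /O trmxB !trmxM !trmxK opprB.
have OE : frobenius (O D1 - O D2) ^+ 2 = 2 * frobenius (D1 - D2) ^+ 2.
  pose E := D1 - D2.
  have V0E : V0^T *m E = 0 by rewrite /E mulmxBr V0D1 V0D2 subrr.
  have ETV0 : E^T *m V0 = 0 by apply: trmx_inj; rewrite trmxM trmxK trmx0.
  have OEq : O D1 - O D2 = E *m V0^T - V0 *m E^T.
    by rewrite /O /E mulmxBl trmxB mulmxBr [in LHS]opprD addrACA -opprD.
  rewrite OEq -/E; move: E V0E ETV0 {OEq} => E V0E ETV0.
  rewrite !sqr_frobenius trmxB !trmxM !trmxK mulmxBl !mulmxBr.
  have -> : V0 *m E^T *m (V0 *m E^T) = 0.
    by rewrite -!mulmxA (mulmxA E^T V0) ETV0 mul0mx mulmx0.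
  have -> : E *m V0^T *m (E *m V0^T) = 0.
    by rewrite -!mulmxA (mulmxA V0^T E) V0E mul0mx mulmx0.
  rewrite subr0 sub0r opprK mxtraceD.
  have -> : E *m V0^T *m (V0 *m E^T) = E *m E^T.
    by rewrite -!mulmxA (mulmxA V0^T V0) V0V0 mul1mx.
  have -> : \tr (V0 *m E^T *m (E *m V0^T)) = \tr (E^T *m E).
    rewrite mxtrace_mulC -!mulmxA (mulmxA V0^T V0) V0V0 mul1mx.
    by rewrite mxtrace_mulC.
  by rewrite [\tr (E *m E^T)]mxtrace_mulC mulr_natl mulr2n.
pose Y1 := exp_curve V0 s1; pose Y2 := exp_curve V0 s2.
have YY1 r : (Y1 r)^T *m Y1 r = 1%:M by apply: exp_curve_stiefel V0V0 V0D1 svd1.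
have YY2 r : (Y2 r)^T *m Y2 r = 1%:M by apply: exp_curve_stiefel V0V0 V0D2 svd2.
have Z2 : frobenius (Y1 1 - Y2 1) <= 2 * frobenius (D1 - D2).
  rewrite -(@ler_pXn2r _ 2) ?nnegrE ?mulr_ge0 ?frobenius_ge0 //.
  have := @skew_flow_distance R n k (O D1) (O D2) Y1 Y2 (skewO D1) YY2.
  rewrite OE => h; rewrite exprMn; apply: le_trans (h _ _ _) _; last by lra.
  - by move=> r i j; apply: is_derive_exp_curve.
  - by move=> r i j; apply: is_derive_exp_curve.
  - by rewrite /Y1 /Y2 (exp_curve0 _ svd1) (exp_curve0 _ svd2).
rewrite -/(Y1 1) -/(Y2 1).
have -> : Y1 1 *m (Y1 1)^T - Y2 1 *m (Y2 1)^T =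
    Y1 1 *m (Y1 1 - Y2 1)^T + (Y1 1 - Y2 1) *m (Y2 1)^T.
  by rewrite trmxB mulmxBr mulmxBl addrA subrK.
apply: le_trans (frobenius_triangle _ _) _.
rewrite frobenius_mul_isometry // -[frobenius (_ *m (Y2 1)^T)]frobenius_trmx trmxM trmxK.
by rewrite frobenius_mul_isometry // !frobenius_trmx; lra.
Qed.

(** * Projectors and the logarithm *)

Lemma mulmx_fix_colspace (R : realType) n m m' (P : 'M[R]_n) (A : 'M[R]_(n, m))
    (B : 'M[R]_(n, m')) :
  P *m A = A -> colspace B = colspace A -> P *m B = B.
Proof.
move=> PA BA; pose g : 'Hom('cV[R]_n, 'cV[R]_n) := linfun (mulmx (P - 1%:M)).
have gE v : (v \in lker g) = (P *m v == v).
  by rewrite (memv_ker g v) (lfunE (mulmx (P - 1%:M))) /= mulmxBl mul1mx subr_eq0.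
have sub : (colspace A <= lker g)%VS.
  apply/span_subvP => v /mapP[j _ ->].
  by rewrite gE colE mulmxA PA.
have fix_col j : P *m col j B = col j B.
  apply/eqP; rewrite -gE; apply: (subvP sub); rewrite -BA.
  by apply: memv_span; apply: map_f; rewrite mem_enum.
apply/matrixP => i j; have /matrixP/(_ i 0) := fix_col j.
rewrite [in RHS]mxE => <-; rewrite !mxE; by apply: eq_bigr => l _; rewrite mxE.
Qed.

Lemma sym_projector_eq (R : realType) n (P Q : 'M[R]_n) :
  P^T = P -> Q^T = Q -> P *m Q = Q -> Q *m P = P -> P = Q.
Proof. by move=> PT QT PQ QP; rewrite -PT -QP trmxM PT QT. Qed.

Lemma stiefel_fix (R : realType) n k (V : 'M[R]_(n, k)) :
  V^T *m V = 1%:M -> V *m V^T *m V = V.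
Proof. by move=> VV; rewrite -mulmxA VV mulmx1. Qed.

Lemma stiefel_rep_projector (R : realType) n k S (V : 'M[R]_(n, k)) (D : 'M[R]_n) :
  stiefel_rep S V -> is_orthproj S D -> V *m V^T = D.
Proof.
move=> [VV VS] [DD DT DS].
have DV : D *m V = V by apply: mulmx_fix_colspace DD _; rewrite VS DS.
have PD : V *m V^T *m D = D.
  by apply: mulmx_fix_colspace (stiefel_fix VV) _; rewrite VS DS.
by apply: sym_projector_eq => //; rewrite ?trmxM ?trmxK // mulmxA DV.
Qed.

(** * The logarithm as a function of the projector *)

Definition log_lift (R : realType) n k (V0 : 'M[R]_(n, k)) (D : 'M[R]_n) : 'M[R]_(n, k) :=
  D *m V0 *m invmx (V0^T *m D *m V0) - V0.

(** With M = V0^T V one has M^-1 = M^T (M M^T)^-1, while V M^T = V V^T V0 and M M^T = V0^T V V^T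
    V0. *)
Lemma log_liftE (R : realType) n k (V0 V : 'M[R]_(n, k)) :
  V0^T *m V \in unitmx ->
  V *m invmx (V0^T *m V) - V0 = log_lift V0 (V *m V^T).
Proof.
move=> Mu; rewrite /log_lift; congr (_ - _); set M := V0^T *m V in Mu *.
have -> : V0^T *m (V *m V^T) *m V0 = M *m M^T by rewrite /M trmxM trmxK !mulmxA.
have MMu : M *m M^T \in unitmx by rewrite unitmx_mul unitmx_tr Mu.
apply: (can_inj (mulmxK MMu)); rewrite mulmxKV // mulmxA mulmxKV //.
by rewrite /M trmxM trmxK mulmxA.
Qed.

(** Both logarithms apply [svd] to the same matrix, so even the chosen triples coincide. This
    reconciles the representatives given at the nodes with those of the trajectory. *)
Lemma Grlog_eq_projector (R : realType) n k (V0 V V' : 'M[R]_(n, k)) :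
  V0^T *m V \in unitmx -> V0^T *m V' \in unitmx -> V *m V^T = V' *m V'^T ->
  Grlog V0 V = Grlog V0 V'.
Proof. by move=> Vu Vu' e; rewrite /Grlog !log_liftE // e. Qed.

Lemma thin_svd_tangent (R : realType) n k (V0 A U : 'M[R]_(n, k)) xi W (y : 'rV[R]_k) :
  V0^T *m A = 0 -> thin_svd A (U, xi, W) -> (forall j, xi 0 j = 0 -> y 0 j = 0) ->
  V0^T *m (U *m diag_mx y *m W^T) = 0.
Proof.
move=> V0A [_ WW _ Ae] xy.
suff e : V0^T *m U *m diag_mx y = 0 by rewrite !mulmxA e mul0mx.
apply: diag_mx_ext0 xy _; rewrite -[LHS]mulmx1 -WW mulmxA.
by rewrite -!mulmxA (mulmxA (diag_mx _)) (mulmxA U) (mulmxA U) -Ae mulmxA V0A mul0mx.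
Qed.

Lemma lift_tangent (R : realType) n k (V0 V : 'M[R]_(n, k)) :
  V0^T *m V0 = 1%:M -> V0^T *m V \in unitmx ->
  V0^T *m (V *m invmx (V0^T *m V) - V0) = 0.
Proof. by move=> V0V0 Mu; rewrite mulmxBr mulmxA mulmxV // V0V0 subrr. Qed.

Lemma sin_atan (R : realType) (x : R) : sin (atan x) = x * cos (atan x).
Proof.
have c0 : cos (atan x) != 0.
  by rewrite cos_atan invr_eq0 gt_eqF // sqrtr_gt0 ltr_pwDl // sqr_ge0.
by rewrite -{2}(atanK x) /tan divfK.
Qed.

Lemma thin_svd_atan (R : realType) n k (A U : 'M[R]_(n, k)) xi W :
  thin_svd A (U, xi, W) ->
  thin_svd (U *m diag_mx (map_mx atan xi) *m W^T) (U, map_mx atan xi, W).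
Proof.
move=> [UU WW xi0 Ae]; split => // i; rewrite mxE.
by rewrite -[leLHS]atan0; exact: le_atan.
Qed.

(** Since sin(atan x) = x cos(atan x), the exponential equals (L + V0) Q = V M^-1 Q, with M = V0^T
    V, L = V M^-1 - V0 and Q = W cos(atan xi) W^T. It and V both have orthonormal columns, so the
    square factor M^-1 Q is orthogonal and cancels in the projector. *)
Lemma exp_log_projector (R : realType) n k (V0 V U : 'M[R]_(n, k)) xi W :
  V0^T *m V0 = 1%:M -> V^T *m V = 1%:M -> V0^T *m V \in unitmx ->
  thin_svd (V *m invmx (V0^T *m V) - V0) (U, xi, W) ->
  exp_curve V0 (U, map_mx atan xi, W) 1 *m (exp_curve V0 (U, map_mx atan xi, W) 1)^T
    = V *m V^T.
Proof.
move=> V0V0 VV Mu svdL; have V0L := lift_tangent V0V0 Mu.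
set M := V0^T *m V in Mu svdL V0L; have [UU WW xi0 Le] := svdL.
have V0D : V0^T *m (U *m diag_mx (map_mx atan xi) *m W^T) = 0.
  by apply: thin_svd_tangent svdL _ => // j e; rewrite mxE e atan0.
have YY := exp_curve_stiefel 1 V0V0 V0D (thin_svd_atan svdL).
set Y := exp_curve _ _ _ in YY *.
pose C := diag_mx (map_mx cos (map_mx atan xi)).
pose Q := W *m C *m W^T.
have YQ : Y = V *m (invmx M *m Q).
  have -> : V *m (invmx M *m Q) = (V *m invmx M - V0) *m Q + V0 *m Q.
    by rewrite mulmxA -mulmxDl subrK.
  rewrite Le /Y /exp_curve scale1r addrC /Q !mulmxA; congr (_ + _).
  rewrite -(mulmxA _ W^T W) WW mulmx1 -(mulmxA U (diag_mx xi)) mulmx_diag.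
  congr (U *m diag_mx _ *m _); apply/matrixP => i j.
  by rewrite !mxE !ord1 sin_atan.
move: YY; rewrite YQ; move: (invmx M *m Q) => G YY.
have GG : G^T *m G = 1%:M.
  by rewrite -YY trmxM -mulmxA (mulmxA V^T V) VV mul1mx.
by rewrite trmxM -mulmxA (mulmxA G G^T) (mulmx1C GG) mul1mx.
Qed.

(** * The resolvent (1 + s^2 A^T A)^-1 *)

Lemma resolvent_factor (R : realType) n k (A U : 'M[R]_(n, k)) xi W (s : R) :
  thin_svd A (U, xi, W) ->
  1%:M + s ^+ 2 *: (A^T *m A) =
  W *m diag_mx (\row_j (1 + s ^+ 2 * xi 0 j ^+ 2)) *m W^T.
Proof.
move=> [UU WW _ ->]; rewrite !trmxM trmxK tr_diag_mx.
have -> : W *m (diag_mx xi *m U^T) *m (U *m diag_mx xi *m W^T) =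
    W *m (diag_mx xi *m diag_mx xi) *m W^T.
  by rewrite -!mulmxA (mulmxA U^T U) UU mul1mx.
rewrite -[in LHS](mulmx1C WW) -{1}[W]mulmx1 scalemxAl scalemxAr -mulmxDl -mulmxDr.
congr (_ *m _ *m _); rewrite mulmx_diag; apply/matrixP => i j.
by rewrite !mxE; case: eqP => _; rewrite ?mulr1n ?mulr0n ?mulr0 ?addr0 // expr2.
Qed.

(** The determinant is the product of the factors 1 + s^2 xi_j^2. A lower bound uniform in s and A
    is what the smoothness of the inverse requires. *)
Lemma resolvent_det_ge1 (R : realType) n k (A : 'M[R]_(n, k)) (s : R) :
  (k <= n)%N -> 1 <= \det (1%:M + s ^+ 2 *: (A^T *m A)).
Proof.
move=> kn; case: (svd A) (svdP A kn) => [[U xi] W] svdA.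
rewrite (resolvent_factor s svdA) !det_mulmx mulrAC -det_mulmx.
have [_ WW _ _] := svdA; rewrite (mulmx1C WW) det1 mul1r det_diag.
elim/big_ind: _ => // [x y x1 y1|i _]; first by rewrite -[1]mulr1 ler_pM.
by rewrite mxE lerDl mulr_ge0 ?sqr_ge0.
Qed.

Lemma resolvent_svd (R : realType) n k (A U : 'M[R]_(n, k)) xi W (s : R) :
  (k <= n)%N -> thin_svd A (U, xi, W) ->
  U *m diag_mx (\row_j (xi 0 j / (1 + s ^+ 2 * xi 0 j ^+ 2))) *m W^T =
  A *m invmx (1%:M + s ^+ 2 *: (A^T *m A)).
Proof.
move=> kn svdA.
have Bu : 1%:M + s ^+ 2 *: (A^T *m A) \in unitmx.
  by rewrite unitmxE unitfE gt_eqF // (lt_le_trans ltr01) // resolvent_det_ge1.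
apply: (can_inj (mulmxK Bu)); rewrite mulmxKV // (resolvent_factor s svdA).
have [UU WW xi0 ->] := svdA.
rewrite -!mulmxA (mulmxA W^T W) WW mul1mx; congr (_ *m _).
rewrite mulmxA mulmx_diag; congr (diag_mx _ *m _).
apply/matrixP => i j; rewrite !mxE !ord1 divfK // gt_eqF //.
by rewrite ltr_pwDl // mulr_ge0 ?sqr_ge0.
Qed.

(** * Derivatives relative to a set *)

Lemma cvg_near_eq (R : realType) (F : set_system R) {FF : Filter F} (f g : R -> R) (l : R) :
  f @ F --> l -> (\forall y \near F, f y = g y) -> g @ F --> l.
Proof. by move=> fl fg; apply: cvg_trans fl; exact: near_eq_cvg. Qed.

(** Asserts that the limit exists, which the bare [lim] in [derive1_within] does not record. *)
Definition has_derive_within (R : realType) (A : set R) (f : R -> R) (x l : R) : Prop :=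
  (f y - f x) / (y - x) @[y --> within A x^'] --> l.

Section WithinDerivative.
Context {R : realType} (A : set R).
Implicit Types (f g : R -> R) (x l : R).

Lemma near_within_dnbhs x : \forall y \near within A x^', A y /\ y != x.
Proof.
by apply: (@filterE _ (nbhs x)) => y yx Ay; split.
Qed.

Lemma derive_within_eq f g x l : A x -> (forall y, A y -> f y = g y) ->
  has_derive_within A f x l -> has_derive_within A g x l.
Proof.
move=> Ax fg; apply: cvg_trans; apply: near_eq_cvg.
by near=> y; rewrite -!fg //; have [] : A y /\ y != x by near: y; exact: near_within_dnbhs.
Unshelve. all: by end_near. Qed.

Lemma has_derive_within_cst (c x : R) : has_derive_within A (fun=> c) x 0.
Proof.
rewrite /has_derive_within (_ : (fun y => _) = fun=> 0); first exact: cvg_cst.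
by apply/funext => y; rewrite subrr mul0r.
Qed.

Lemma has_derive_withinD f g x l l' : has_derive_within A f x l ->
  has_derive_within A g x l' -> has_derive_within A (fun y => f y + g y) x (l + l').
Proof.
rewrite /has_derive_within => fl gl; apply: (cvg_near_eq (cvgD fl gl)).
by apply: nearW => y /=; rewrite -mulrDl opprD addrACA.
Qed.

Lemma has_derive_within_cvg f x l : has_derive_within A f x l ->
  f y @[y --> within A x^'] --> f x.
Proof.
rewrite /has_derive_within => fl; have yx : y - x @[y --> within A x^'] --> x - x.
  apply: cvgB; last exact: cvg_cst.
  by apply: cvg_within_filter; apply: cvg_within_filter; exact: cvg_id.
have e : l * (x - x) + f x = f x by rewrite subrr mulr0 add0r.
have h : (f y - f x) / (y - x) * (y - x) + f x @[y --> within A x^'] --> l * (x - x) + f x.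
  by apply: cvgD; [exact: cvgM | exact: cvg_cst].
rewrite e in h; apply: (cvg_near_eq h); near=> y => /=.
have [_ y0] : A y /\ y != x by near: y; exact: near_within_dnbhs.
by rewrite divfK ?subr_eq0 // subrK.
Unshelve. all: by end_near. Qed.

Lemma has_derive_withinM f g x l l' : has_derive_within A f x l ->
  has_derive_within A g x l' ->
  has_derive_within A (fun y => f y * g y) x (l * g x + f x * l').
Proof.
rewrite /has_derive_within => fl gl; have gx := has_derive_within_cvg gl.
have h : (f y - f x) / (y - x) * g y + f x * ((g y - g x) / (y - x)) @[y --> within A x^']
    --> l * g x + f x * l'.
  by apply: cvgD; apply: cvgM => //; exact: cvg_cst.
apply: (cvg_near_eq h); near=> y.
have [_ y0] : A y /\ y != x by near: y; exact: near_within_dnbhs.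
by field; rewrite subr_eq0.
Unshelve. all: by end_near. Qed.

Lemma has_derive_withinV f x l : f x != 0 -> (forall y, A y -> f y != 0) ->
  has_derive_within A f x l ->
  has_derive_within A (fun y => (f y)^-1) x (- l * (f x)^-1 * (f x)^-1).
Proof.
rewrite /has_derive_within => fx0 fy0 fl; have fx := has_derive_within_cvg fl.
have h : - ((f y - f x) / (y - x)) * (f y)^-1 * (f x)^-1 @[y --> within A x^']
    --> - l * (f x)^-1 * (f x)^-1.
  by apply: cvgM; [apply: cvgM; [exact: cvgN | exact: cvgV] | exact: cvg_cst].
apply: (cvg_near_eq h); near=> y.
have [Ay y0] : A y /\ y != x by near: y; exact: near_within_dnbhs.
by field; rewrite subr_eq0 y0 fx0 fy0.
Unshelve. all: by end_near. Qed.

Lemma derive1_withinE f x l : ProperFilter (within A x^') ->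
  has_derive_within A f x l -> derive1_within A f x = l.
Proof. by move=> pF fl; apply: cvg_lim fl. Qed.

(** A quadratic remainder estimate is stable under integration in a parameter; it replaces a
    dominated convergence argument when differentiating under the integral sign. *)
Lemma has_derive_within_bound f x l K :
  (forall y, A y -> `|f y - f x - l * (y - x)| <= K * (y - x) ^+ 2) ->
  has_derive_within A f x l.
Proof.
move=> h; apply/cvgrPdist_le => e e0; near=> y.
have [Ay y0] : A y /\ y != x by near: y; exact: near_within_dnbhs.
have yx0 : 0 < `|y - x| by rewrite normr_gt0 subr_eq0.
have -> : l - (f y - f x) / (y - x) = - (f y - f x - l * (y - x)) / (y - x).
  by field; rewrite subr_eq0.
rewrite normrM normrN normfV ler_pdivrMr //; apply: le_trans (h _ Ay) _.
rewrite -[(y - x) ^+ 2]ger0_norm ?sqr_ge0 // normrX expr2 mulrA ler_pM2r //.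
(* [K] may vanish or be negative; [|K| + 1] is a positive divisor for the radius. *)
apply: (@le_trans _ _ ((`|K| + 1) * `|y - x|)).
  by rewrite ler_pM2r // (le_trans (ler_norm K)) // lerDl.
rewrite mulrC -ler_pdivlMr ?ltr_wpDl //.
near: y; apply: (cvg_within); apply: cvg_within.
have K0 : 0 < e / (`|K| + 1) by rewrite divr_gt0 // ltr_wpDl.
apply: filterS (nbhsx_ballx x _ K0) => y.
by rewrite /ball /= distrC => /ltW.
Unshelve. all: by end_near. Qed.

End WithinDerivative.

(** * Comparison with ordinary derivatives, and the mean value theorem *)

Lemma nbhs_translate (R : realType) (P : set R) (x : R) :
  nbhs 0 (fun h => P (h + x)) <-> nbhs x P.
Proof.
split=> /nbhs_ballP[e /= e0 h]; apply/nbhs_ballP; exists e => // y; rewrite /ball /= => xy.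
  rewrite -[y](subrK x); apply: h.
  by rewrite /ball /= sub0r normrN distrC.
by apply: h; rewrite /ball /= opprD addrCA subrr addr0 normrN; rewrite sub0r normrN in xy.
Qed.

Lemma difference_quotientP (R : realType) (f : R -> R) (x l : R) :
  (f y - f x) / (y - x) @[y --> x^'] --> l <-> is_derive x (1 : R) f l.
Proof.
have qE h : h^-1 *: (f (h *: (1 : R) + x) - f x) = (f (h + x) - f x) / (h + x - x).
  by rewrite /GRing.scale /= mulr1 addrK mulrC.
split => [fl|[df dfl]].
  have h : h^-1 *: (f (h *: (1 : R) + x) - f x) @[h --> 0^'] --> l.
    apply/cvgrPdist_le => e e0; move/cvgrPdist_le: fl => /(_ e e0).
    rewrite /prop_near1 /= /dnbhs /within /= => /(proj2 (nbhs_translate _ _)).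
    apply: filterS => y hy y0; rewrite qE; apply: hy.
    by rewrite -subr_eq0 addrK.
  by apply: DeriveDef; [apply/cvg_ex; exists l | apply: cvg_lim h].
have h : h^-1 *: (f (h *: (1 : R) + x) - f x) @[h --> 0^'] --> l.
  by rewrite -dfl; apply: df.
apply/cvgrPdist_le => e e0; move/cvgrPdist_le: h => /(_ e e0).
rewrite /prop_near1 /= /dnbhs /within /= => fl.
have {}fl : nbhs 0 (fun t : R => t != 0 -> `|l - t^-1 *: (f (t *: (1 : R) + x) - f x)| <= e) := fl.
apply: (proj1 (nbhs_translate _ _)); apply: filterS fl => y hy y0.
by rewrite -qE; apply: hy; apply: contra_neq y0 => ->; rewrite add0r.
Qed.

Lemma is_derive_has_within (R : realType) (A : set R) (f : R -> R) (x l : R) :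
  is_derive x (1 : R) f l -> has_derive_within A f x l.
Proof. by move=> /difference_quotientP; exact: cvg_within_filter. Qed.

Lemma has_within_is_derive (R : realType) (A : set R) (f : R -> R) (x l : R) :
  nbhs x A -> has_derive_within A f x l -> is_derive x (1 : R) f l.
Proof.
move=> Ax fl; apply/difference_quotientP => P /fl; rewrite /nbhs /= /within /= => h.
rewrite /dnbhs /within /=; apply: filterS2 Ax h => y Ay h yx; exact: h.
Qed.

Lemma has_derive_within_continuous (R : realType) (A : set R) (f g : R -> R) :
  (forall x, A x -> has_derive_within A f x (g x)) -> {within A, continuous f}.
Proof.
move=> fg; apply/subspace_continuousP => x Ax P /= Px.
have h : nbhs x (fun y => y != x -> A y -> P (f y)) := has_derive_within_cvg (fg x Ax) Px.
change (nbhs x (fun y => A y -> P (f y))).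
apply: filterS h => y h Ay; have [->|yx] := eqVneq y x; last exact: h.
exact: nbhs_singleton.
Qed.

(** Every point of a nondegenerate interval is an accumulation point of it. This makes limits of
    difference quotients unique, so that [derive1_within] takes the expected value at the endpoints
    too. *)
Lemma itv_within_proper (R : realType) (a b x : R) : a < b -> a <= x <= b ->
  ProperFilter (within `[a, b]%classic x^').
Proof.
move=> ab /andP[ax xb]; apply: Build_ProperFilter => /=.
rewrite /within /dnbhs /within /= => /nbhs_ballP[e /= e0 h].
have [xltb|bx] := ltP x b.
- pose y := Num.min (x + e / 2) b.
  have xy : x < y by rewrite lt_min xltb andbT ltrDl divr_gt0.
  apply: (h y); last 2 first.
  + by rewrite gt_eqF.
  + by rewrite /= in_itv /= (le_trans ax (ltW xy)) /y ge_min lexx orbT.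
  rewrite /ball /= distrC gtr0_norm ?subr_gt0 // ltrBlDl.
  by rewrite gt_min ltrD2l ltr_pdivrMr // ltr_pMr // ltr1n.
- have {bx xb} xb : x = b by apply/eqP; rewrite eq_le xb bx.
  pose y := Num.max (x - e / 2) a.
  have yx : y < x by rewrite gt_max gtrDl oppr_lt0 divr_gt0 // xb ab.
  apply: (h y); last 2 first.
  + by rewrite lt_eqF.
  + by rewrite /= in_itv /= -xb (ltW yx) andbT /y le_max lexx orbT.
  rewrite /ball /= gtr0_norm ?subr_gt0 // ltrBlDr -ltrBlDl.
  by rewrite lt_max ltrD2l ltrN2 ltr_pdivrMr // ltr_pMr // ltr1n.
Qed.

Lemma itv_interior_nbhs (R : realType) (a b x : R) :
  a < x < b -> nbhs x `[a, b]%classic.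
Proof.
move=> axb; have xin : x \in `]a, b[ by rewrite in_itv.
apply: filterS (near_in_itvoo xin) => y; rewrite /= !in_itv /= => /andP[ay yb].
by rewrite (ltW ay) (ltW yb).
Qed.

Lemma MVT_within (R : realType) (a b : R) (f g : R -> R) (x y : R) :
  (forall t, `[a, b]%classic t -> has_derive_within `[a, b] f t (g t)) ->
  a <= x -> x < y -> y <= b ->
  exists2 c, x < c < y & f y - f x = g c * (y - x).
Proof.
move=> fg ax xy yb.
have [c] : exists2 c, c \in `]x, y[%R & f y - f x = g c * (y - x).
  apply: MVT => // [t|].
    rewrite in_itv /= => /andP[xt ty].
    apply: (@has_within_is_derive _ `[a, b]%classic).
      by apply: itv_interior_nbhs; rewrite (le_lt_trans ax xt) (lt_le_trans ty yb).
    by apply: fg; rewrite /= in_itv /= (ltW (le_lt_trans ax xt)) (ltW (lt_le_trans ty yb)).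
  apply: continuous_subspaceW (has_derive_within_continuous fg).
  move=> t; rewrite /= !in_itv /= => /andP[xt ty].
  by rewrite (le_trans ax xt) (le_trans ty yb).
by rewrite in_itv /= => xcy e; exists c.
Qed.

(** Covers both orders of x and y; the bound on [|c - x|] allows a second application between x and
    c to end in a quadratic estimate. *)
Lemma MVT_within_dist (R : realType) (a b : R) (f g : R -> R) (x y : R) :
  (forall t, `[a, b]%classic t -> has_derive_within `[a, b] f t (g t)) ->
  `[a, b]%classic x -> `[a, b]%classic y ->
  exists c, [/\ `[a, b]%classic c, `|c - x| <= `|y - x| & f y - f x = g c * (y - x)].
Proof.
rewrite /= !in_itv /= => fg /andP[ax xb] /andP[ay yb].
have [xy|yx|->] := ltgtP x y.
- have [c /andP[xc cy] e] := MVT_within fg ax xy yb.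
  exists c; rewrite in_itv /= (le_trans ax (ltW xc)) (le_trans (ltW cy) yb); split => //.
  by rewrite !gtr0_norm ?subr_gt0 // lerD2r ltW.
- have [c /andP[yc cx] e] := MVT_within fg ay yx xb.
  exists c; rewrite in_itv /= (le_trans ay (ltW yc)) (le_trans (ltW cx) xb); split => //.
    by rewrite !ltr0_norm ?subr_lt0 // lerN2 lerD2r ltW.
  by rewrite -opprB e; ring.
- by exists y; rewrite in_itv /= ay yb !subrr mulr0.
Qed.

Lemma within_continuous_bounded (R : realType) (a b : R) (f : R -> R) : a <= b ->
  {within `[a, b], continuous f} ->
  exists K, forall t, `[a, b]%classic t -> `|f t| <= K.
Proof.
move=> ab fc.
have [c1 _ h1] := EVT_max ab fc; have [c2 _ h2] := EVT_min ab fc.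
exists (Num.max (f c1) (- f c2)) => t At.
by rewrite ler_norml lerNl !le_max lerN2 h1 // h2 // orbT.
Qed.

(** * Power series and real analytic functions *)

(** For |z| < w < |K|, factoring w^(n+1) - |z|^(n+1) gives (w - |z|) (n + 1) |z|^n <= w^(n+1), so
    the derived series is dominated by a multiple of the absolutely convergent series of c at w. *)
Lemma is_cvg_pseries_diffs (R : realType) (c : R^nat) (K z : R) :
  cvgn (pseries c K) -> `|z| < `|K| -> cvgn (pseries (pseries_diffs c) z).
Proof.
move=> cK zK; pose w := (`|z| + `|K|) / 2.
have zw : `|z| < w by rewrite /w; lra.
have wK : `|w| < `|K| by rewrite ger0_norm ?(le_trans _ (ltW zw)) // /w; lra.
have w0 : 0 < w by rewrite (le_lt_trans _ zw).
have cw := is_cvg_pseries_inside_norm cK wK.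
pose u n := `|c n| * w ^+ n.
have cu : cvgn (series (fun n => u n.+1)).
  rewrite (_ : series _ = (fun n => series u n.+1 - cst (u 0%N) n)); last first.
    apply/funext => n; rewrite /series /= big_nat_recl // addrC addrA.
    by rewrite [- _ + _]addrC subrr add0r.
  apply: is_cvgB; last exact: is_cvg_cst.
  by apply/cvg_ex; exists (limn (series u)); rewrite cvg_shiftS; exact: cw.
have cv : cvgn (series (fun n => (w - `|z|)^-1 * u n.+1)).
  exact: is_cvg_seriesZ.
apply: normed_cvg; apply: series_le_cvg cv => [n|n|n]; first exact: normr_ge0.
  by rewrite !mulr_ge0 // ?exprn_ge0 ?invr_ge0 ?subr_ge0 // ltW.
rewrite /pseries_diffs /= !normrM normrX normr_nat mulrC ler_pdivlMl ?subr_gt0 //.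
have -> : (w - `|z|) * (`|z| ^+ n * (n.+1%:R * `|c n.+1|)) =
    `|c n.+1| * ((w - `|z|) * (n.+1%:R * `|z| ^+ n)) by ring.
rewrite /u ler_wpM2l //.
apply: (@le_trans _ _ (w ^+ n.+1 - `|z| ^+ n.+1)); last by rewrite gerBl exprn_ge0.
rewrite subrXX ler_pM2l ?subr_gt0 //.
rewrite -[X in X%:R](card_ord n.+1) mulr_natl -sumr_const ler_sum // => i _.
rewrite -{1}(subnK (ltn_ord i : i <= n)%N) exprD ler_wpM2r ?exprn_ge0 //.
by rewrite /= lerXn2r ?nnegrE // ltW.
Qed.

Lemma is_derive_pseries (R : realType) (c : R^nat) (K x : R) :
  cvgn (pseries c K) -> `|x| < `|K| ->
  is_derive x (1 : R) (fun x => limn (pseries c x)) (limn (pseries (pseries_diffs c) x)).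
Proof.
(* The points |x|, |x| + d, |x| + 2 d, |K| are equally spaced: each gap absorbs one loss of radius,
   and the series together with its first two derived series converge at |x| + d. *)
move=> cK xK; pose nx := `|x|; pose d := (`|K| - nx) / 3.
have nxK : nx < `|K| := xK.
have d0 : 0 < d by rewrite /d divr_gt0 // subr_gt0.
have nE r : 0 <= r -> `|nx + r| = nx + r.
  by move=> r0; rewrite ger0_norm // addr_ge0 // /nx normr_ge0.
have ddK : nx + (d + d) < `|K| by move: nxK; rewrite /d; clear; lra.
have c1 : cvgn (pseries (pseries_diffs c) (nx + (d + d))).
  by apply: is_cvg_pseries_diffs cK _; rewrite nE // addr_ge0 // ltW.
have xd : `|nx + d| < `|nx + (d + d)|.
  by rewrite !nE ?addr_ge0 ?(ltW d0) // ltrD2l ltrDl.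
apply: (@pseries_snd_diffs _ _ (nx + d)).
- apply: is_cvg_pseries_inside cK _; rewrite nE ?(ltW d0) //.
  by apply: lt_trans ddK; rewrite ltrD2l ltrDl.
- exact: is_cvg_pseries_inside c1 xd.
- exact: is_cvg_pseries_diffs c1 xd.
- by rewrite nE ?(ltW d0) // ltrDl.
Qed.

(** Near each point the derivative within the interval is the sum of the derived power series, so
    the single function [derive1_within] glues the local sums together and is analytic again. *)
Lemma real_analytic_derive (R : realType) (a b : R) (f : R -> R) : a < b ->
  real_analytic_on `[a, b] f ->
  exists2 g, real_analytic_on `[a, b] g &
    forall x, `[a, b]%classic x -> has_derive_within `[a, b] f x (g x).
Proof.
move=> ab fan; pose g := derive1_within `[a, b] f.
have loc t0 : `[a, b]%classic t0 -> exists c : nat -> R, exists2 r : R, 0 < r &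
    forall t, `[a, b]%classic t -> `|t - t0| < r ->
    has_derive_within `[a, b] f t (g t) /\ pseries c (t - t0) @ \oo --> g t.
  move=> At0; have [c [r r0 fc]] := fan t0 At0.
  have /andP[at0 t0b] : a <= t0 <= b by move: At0; rewrite /= in_itv.
  (* At an endpoint the series is known to converge only for increments into the interval. As [rho]
     is at most half the length, one of t0 + rho and t0 - rho lies in [a, b], and convergence there
     gives convergence for all increments shorter than [rho], on either side. *)
  pose rho := Num.min r (b - a) / 2.
  have rho0 : 0 < rho by rewrite divr_gt0 // lt_min r0 subr_gt0.
  have rhor : rho < r.
    by rewrite /rho ltr_pdivrMr // gt_min ltr_pMr // ltr1n.
  have rhoba : rho <= (b - a) / 2 by rewrite ler_pM2r ?invr_gt0 // ge_min lexx orbT.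
  have [K KA Krho] : exists2 K, `[a, b]%classic (t0 + K) & `|K| = rho.
    have [h|h] := leP t0 ((a + b) / 2).
      by exists rho; rewrite ?gtr0_norm //= in_itv /=; apply/andP; split; lra.
    by exists (- rho); rewrite ?normrN ?gtr0_norm //= in_itv /=; apply/andP; split; lra.
  have cK : cvgn (pseries c K).
    have e : t0 + K - t0 = K by rewrite addrC addKr.
    have := fc _ KA; rewrite e Krho => /(_ rhor) h.
    by apply/cvg_ex; exists (f (t0 + K)).
  exists (pseries_diffs c), rho => // t At tt0.
  have dF := is_derive_pseries cK (_ : `|t - t0| < `|K|).
  rewrite Krho in dF; have {}dF := dF tt0.
  have d1 : is_derive t (1 : R) (fun y => y - t0) 1.
    by apply: is_derive_eq; rewrite subr0.
  have /(@is_derive_has_within _ `[a, b]%classic) :=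
    @is_derive1_comp _ _ (fun y => y - t0) t _ _ dF d1.
  set l := limn _; rewrite mulr1 => h.
  have {}h : has_derive_within `[a, b] f t l.
    apply: (cvg_near_eq h); near=> y.
    have fE y' : `[a, b]%classic y' -> `|y' - t0| < rho ->
        f y' = limn (pseries c (y' - t0)).
      by move=> Ay' yt'; apply/esym/cvg_lim => //; apply: fc => //; exact: lt_trans rhor.
    have [Ay _] : `[a, b]%classic y /\ y != t by near: y; exact: near_within_dnbhs.
    rewrite /= !fE //; near: y.
    have e0 : 0 < rho - `|t - t0| by rewrite subr_gt0.
    apply: cvg_within; apply: cvg_within.
    apply: filterS (nbhsx_ballx t _ e0) => y; rewrite /ball /= => yt.
    rewrite -[y](subrK t) -addrA (le_lt_trans (ler_normD _ _)) //.
    by rewrite distrC in yt; rewrite -ltrBrDr.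
  have gt : g t = l.
    by apply: derive1_withinE h; apply: itv_within_proper => //; move: At; rewrite /= in_itv.
  rewrite gt; split => //; apply: is_cvg_pseries_diffs cK _.
  by rewrite Krho.
exists g => [t0 /loc[c [r r0 h]]|x /[dup] Ax /loc[c [r r0 h]]].
  by exists c, r => // t At tt0; have [] := h t At tt0.
by have [] := h x Ax; rewrite // subrr normr0.
Unshelve. all: by end_near. Qed.

(** * Smooth families and parametric integrals *)

(* Continuity in s and uniform bounds on [0, 1] x A are what differentiating the integral over
   s in [0, 1] under the integral sign requires. *)
Fixpoint smooth_family (R : realType) (A : set R) (m : nat) (h : R -> R -> R) : Prop :=
  [/\ exists K, forall s t, 0 <= s <= 1 -> A t -> `|h s t| <= K,
      forall t, A t -> continuous (fun s => h s t)
    & if m is m'.+1 then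
        exists2 h', smooth_family A m' h' &
          forall s t, A t -> has_derive_within A (h s) t (h' s t)
      else True].

Section SmoothFamily.
Context {R : realType} (A : set R).
Implicit Types (h g : R -> R -> R) (m : nat).

Lemma smooth_familyW m h : smooth_family A m.+1 h -> smooth_family A m h.
Proof.
elim: m h => [|m IH] h [hK hc [h' sh' hh']]; first by split.
by split => //; exists h' => //; exact: IH.
Qed.

Lemma smooth_family_ext m h g : (forall s t, A t -> h s t = g s t) ->
  smooth_family A m h -> smooth_family A m g.
Proof.
case: m => [|m] hg [[K hK] hc hd]; split => //.
- by exists K => s t s01 At; rewrite -hg // hK.
- by move=> t At; rewrite (_ : (fun s => g s t) = (fun s => h s t)) //;
    [exact: hc | apply/funext => s; rewrite hg].
- by exists K => s t s01 At; rewrite -hg // hK.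
- by move=> t At; rewrite (_ : (fun s => g s t) = (fun s => h s t)) //;
    [exact: hc | apply/funext => s; rewrite hg].
- case: hd => h' sh' hh'; exists h' => // s t At.
  by apply: derive_within_eq (hh' s t At) => // y Ay; rewrite hg.
Qed.

Lemma smooth_family_cst m (c : R) : smooth_family A m (fun _ _ => c).
Proof.
elim: m c => [|m IH] c; split; try by exists `|c|.
- by move=> t _ s; exact: cvg_cst.
- by [].
- by move=> t _ s; exact: cvg_cst.
- by exists (fun _ _ => 0) => // s t _; exact: has_derive_within_cst.
Qed.

Lemma smooth_family_param m (c : R -> R) : continuous c ->
  smooth_family A m (fun s _ => c s).
Proof.
move=> cc; have cK : exists K, forall s t, 0 <= s <= 1 -> A t -> `|c s| <= K.
  have [K hK] : exists K, forall t, `[0, 1]%classic t -> `|c t| <= K.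
    by apply: within_continuous_bounded => //; exact: continuous_subspaceT.
  by exists K => s t s01 _; apply: hK; rewrite /= in_itv.
case: m => [|m]; split => //; exists (fun _ _ => 0) => [|s t _].
  exact: smooth_family_cst.
exact: has_derive_within_cst.
Qed.

Lemma smooth_familyD m h g : smooth_family A m h -> smooth_family A m g ->
  smooth_family A m (fun s t => h s t + g s t).
Proof.
elim: m h g => [|m IH] h g [[K hK] hc hd] [[L gL] gc gd]; split.
- by exists (K + L) => s t s01 At; rewrite (le_trans (ler_normD _ _)) // lerD ?hK ?gL.
- by move=> t At s; apply: cvgD; [exact: hc | exact: gc].
- by [].
- by exists (K + L) => s t s01 At; rewrite (le_trans (ler_normD _ _)) // lerD ?hK ?gL.
- by move=> t At s; apply: cvgD; [exact: hc | exact: gc].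
- case: hd gd => h' sh' hh' [g' sg' gg'].
  exists (fun s t => h' s t + g' s t); first exact: IH.
  by move=> s t At; apply: has_derive_withinD; [exact: hh' | exact: gg'].
Qed.

Lemma smooth_familyM m h g : smooth_family A m h -> smooth_family A m g ->
  smooth_family A m (fun s t => h s t * g s t).
Proof.
elim: m h g => [|m IH] h g sh sg; have [[K hK] hc hd] := sh;
  have [[L gL] gc gd] := sg; split => //.
- by exists (K * L) => s t s01 At; rewrite normrM ler_pM ?hK ?gL.
- by move=> t At s; apply: cvgM; [exact: hc | exact: gc].
- by exists (K * L) => s t s01 At; rewrite normrM ler_pM ?hK ?gL.
- by move=> t At s; apply: cvgM; [exact: hc | exact: gc].
- case: hd gd => h' sh' hh' [g' sg' gg'].
  exists (fun s t => h' s t * g s t + h s t * g' s t).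
    by apply: smooth_familyD; apply: IH => //; exact: smooth_familyW.
  by move=> s t At; apply: has_derive_withinM; [exact: hh' | exact: gg'].
Qed.

Lemma smooth_familyV m h (c : R) : 0 < c -> (forall s t, A t -> c <= `|h s t|) ->
  smooth_family A m h -> smooth_family A m (fun s t => (h s t)^-1).
Proof.
move=> c0 ch; have h0 s t : A t -> h s t != 0.
  by move=> At; rewrite -normr_gt0 (lt_le_trans c0) // ch.
have hV : exists K, forall s t, 0 <= s <= 1 -> A t -> `|(h s t)^-1| <= K.
  by exists c^-1 => s t _ At; rewrite normfV lef_pV2 ?posrE ?ch // normr_gt0 h0.
elim: m => [|m IH] sh; have [hK hc hd] := sh; split => //.
- by move=> t At s; apply: cvgV; [exact: h0 | exact: hc].
- by move=> t At s; apply: cvgV; [exact: h0 | exact: hc].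
- case: hd => h' sh' hh'.
  have sV := IH (smooth_familyW sh).
  exists (fun s t => - h' s t * (h s t)^-1 * (h s t)^-1).
    do 2 apply: smooth_familyM => //.
    apply: (@smooth_family_ext _ (fun s t => (-1) * h' s t)).
      by move=> s t _; rewrite mulN1r.
    by apply: smooth_familyM => //; exact: smooth_family_cst.
  move=> s t At; apply: has_derive_withinV (hh' s t At); first exact: h0.
  by move=> y Ay; exact: h0.
Qed.

Lemma smooth_family_sum m (I : Type) (r : seq I) (P : pred I) (h : I -> R -> R -> R) :
  (forall i, smooth_family A m (h i)) ->
  smooth_family A m (fun s t => \sum_(i <- r | P i) h i s t).
Proof.
move=> sh; elim: r => [|i r IH].
  apply: (@smooth_family_ext _ (fun _ _ => 0)); first by move=> s t _; rewrite big_nil.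
  exact: smooth_family_cst.
apply: (@smooth_family_ext _ (fun s t => (if P i then h i s t else 0) +
    \sum_(j <- r | P j) h j s t)).
  by move=> s t _; rewrite big_cons; case: (P i); rewrite ?add0r.
by apply: smooth_familyD => //; case: (P i) => //; exact: smooth_family_cst.
Qed.

Lemma smooth_family_prod m (I : Type) (r : seq I) (P : pred I) (h : I -> R -> R -> R) :
  (forall i, smooth_family A m (h i)) ->
  smooth_family A m (fun s t => \prod_(i <- r | P i) h i s t).
Proof.
move=> sh; elim: r => [|i r IH].
  apply: (@smooth_family_ext _ (fun _ _ => 1)); first by move=> s t _; rewrite big_nil.
  exact: smooth_family_cst.
apply: (@smooth_family_ext _ (fun s t => (if P i then h i s t else 1) *
    \prod_(j <- r | P j) h j s t)).
  by move=> s t _; rewrite big_cons; case: (P i); rewrite ?mul1r.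
by apply: smooth_familyM => //; case: (P i) => //; exact: smooth_family_cst.
Qed.

Definition smooth_family_mx m p q (M : R -> R -> 'M[R]_(p, q)) : Prop :=
  forall i j, smooth_family A m (fun s t => M s t i j).

Lemma smooth_family_mx_cst m p q (M : 'M[R]_(p, q)) : smooth_family_mx m (fun _ _ => M).
Proof. by move=> i j; exact: smooth_family_cst. Qed.

Lemma smooth_family_mxD m p q (M N : R -> R -> 'M[R]_(p, q)) :
  smooth_family_mx m M -> smooth_family_mx m N -> smooth_family_mx m (fun s t => M s t + N s t).
Proof.
move=> sM sN i j; apply: smooth_family_ext (smooth_familyD (sM i j) (sN i j)).
by move=> s t _; rewrite mxE.
Qed.

Lemma smooth_family_mxZ m p q h (M : R -> R -> 'M[R]_(p, q)) :
  smooth_family A m h -> smooth_family_mx m M -> smooth_family_mx m (fun s t => h s t *: M s t).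
Proof.
move=> sh sM i j; apply: smooth_family_ext (smooth_familyM sh (sM i j)).
by move=> s t _; rewrite mxE.
Qed.

Lemma smooth_family_trmx m p q (M : R -> R -> 'M[R]_(p, q)) :
  smooth_family_mx m M -> smooth_family_mx m (fun s t => (M s t)^T).
Proof.
by move=> sM i j; apply: smooth_family_ext (sM j i) => s t _; rewrite mxE.
Qed.

Lemma smooth_family_mulmx m p q r (M : R -> R -> 'M[R]_(p, q)) (N : R -> R -> 'M[R]_(q, r)) :
  smooth_family_mx m M -> smooth_family_mx m N -> smooth_family_mx m (fun s t => M s t *m N s t).
Proof.
move=> sM sN i j.
apply: (@smooth_family_ext _ (fun s t => \sum_l M s t i l * N s t l j)).
  by move=> s t _; rewrite mxE.
by apply: smooth_family_sum => l; apply: smooth_familyM.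
Qed.

Lemma smooth_family_det m p (M : R -> R -> 'M[R]_p) :
  smooth_family_mx m M -> smooth_family A m (fun s t => \det (M s t)).
Proof.
move=> sM; rewrite /determinant; apply: smooth_family_sum => l.
apply: smooth_familyM; first exact: smooth_family_cst.
by apply: smooth_family_prod => i; exact: sM.
Qed.

(** Cramer's rule: the entries are cofactors, polynomial in the entries of M, divided by a
    determinant bounded away from 0. *)
Lemma smooth_family_invmx m p (M : R -> R -> 'M[R]_p) (c : R) :
  0 < c -> (forall s t, A t -> c <= `|\det (M s t)|) ->
  smooth_family_mx m M -> smooth_family_mx m (fun s t => invmx (M s t)).
Proof.
move=> c0 cM sM i j.
have Mu s t : A t -> M s t \in unitmx.
  by move=> At; rewrite unitmxE unitfE -normr_gt0 (lt_le_trans c0) // cM.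
apply: (@smooth_family_ext _ (fun s t => (\det (M s t))^-1 *
    ((-1) ^+ (j + i) * \det (row' j (col' i (M s t)))))).
  by move=> s t At; rewrite /invmx Mu // !mxE.
apply: smooth_familyM.
  by apply: smooth_familyV c0 cM _; exact: smooth_family_det.
apply: smooth_familyM; first exact: smooth_family_cst.
apply: smooth_family_det => i' j'.
by apply: smooth_family_ext (sM (lift j i') (lift i j')) => s t _; rewrite !mxE.
Qed.

End SmoothFamily.

Lemma smooth_family_analytic (R : realType) (a b : R) (f : R -> R) (m : nat) : a < b ->
  real_analytic_on `[a, b] f -> smooth_family `[a, b] m (fun _ t => f t).
Proof.
move=> ab; elim: m f => [|m IH] f fan; have [g gan fg] := real_analytic_derive ab fan.
- split => //; last by move=> t _ s; exact: cvg_cst.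
  have [K hK] := within_continuous_bounded (ltW ab) (has_derive_within_continuous fg).
  by exists K => _ t _; exact: hK.
- split; last by exists (fun _ => g) => [|_]; [exact: IH | exact: fg].
    have [K hK] := within_continuous_bounded (ltW ab) (has_derive_within_continuous fg).
    by exists K => _ t _; exact: hK.
  by move=> t _ s; exact: cvg_cst.
Qed.

(** * Parameter integrals over [0, 1] *)

Section UnitIntegral.
Context {R : realType}.
Let mu := @lebesgue_measure R.
Implicit Types (f g : R -> R).

Lemma integrable_unit f : continuous f -> mu.-integrable `[0, 1] (EFin \o f).
Proof.
move=> fc; apply: continuous_compact_integrable; first exact: segment_compact.
exact: continuous_subspaceT.
Qed.

Lemma Rintegral_unit_cst (c : R) : (\int[mu]_(s in `[0, 1]) c = c)%R.
Proof.
have mu01 : lebesgue_measure (`[0, 1]%classic : set R) = 1%:E.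
  by rewrite lebesgue_measure_itv /= lte_fin ltr01 oppr0 adde0.
by rewrite Rintegral_cst //; transitivity (c * fine 1%:E); [rewrite -mu01 | exact: mulr1].
Qed.

Lemma le_norm_Rintegral_unit f (K : R) : continuous f ->
  (forall s, 0 <= s <= 1 -> `|f s| <= K) -> `|\int[mu]_(s in `[0, 1]) f s| <= K.
Proof.
move=> fc fK; apply: le_trans (le_normr_Rintegral _ (integrable_unit fc)) _ => //.
rewrite -[leRHS](Rintegral_unit_cst K); apply: le_Rintegral => //.
- by apply: integrable_unit => s; apply: continuous_comp; [exact: fc | exact: norm_continuous].
- by apply: integrable_unit => s; exact: cvg_cst.
Qed.

(** The remainder h(s, y) - h(s, x) - h1(s, x) (y - x) is at most K2 (y - x)^2 uniformly in s, where
    K2 bounds the second derivative in t, and integration over s preserves this. The margin of two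
    orders keeps such a bound available at each differentiation. *)
Lemma smooth_family_integral (a b : R) (m : nat) (h : R -> R -> R) :
  smooth_family `[a, b] m.+2 h ->
  smooth_family `[a, b] m (fun _ t => \int[mu]_(s in `[0, 1]) h s t).
Proof.
elim: m h => [|m IH] h sh.
- have [[K hK] hc _] := sh; split => //; last by move=> t _ s; exact: cvg_cst.
  exists K => _ t _ At; apply: le_norm_Rintegral_unit; first exact: hc.
  by move=> s s01; exact: hK.
- have [[K hK] hc [h1 sh1 hh1]] := sh.
  have [[K1 h1K] h1c [h2 sh2 hh2]] := sh1.
  have {sh2} [[K2 h2K] _ _] := sh2.
  split; last 1 first.
  + exists (fun _ t => \int[mu]_(s in `[0, 1]) h1 s t); first exact: IH.
    move=> _ x Ax; apply: (@has_derive_within_bound _ _ _ _ _ K2) => y Ay.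
    have -> : \int[mu]_(s in `[0, 1]) h s y - \int[mu]_(s in `[0, 1]) h s x -
        (\int[mu]_(s in `[0, 1]) h1 s x) * (y - x) =
        \int[mu]_(s in `[0, 1]) (h s y - h s x - h1 s x * (y - x)).
      rewrite RintegralB //; last 2 first.
      * by apply: (@integrable_unit (fun s => h s y - h s x)) => s; apply: cvgB; exact: hc.
      * apply: (@integrable_unit (fun s => h1 s x * (y - x))) => s.
        by apply: cvgM; [exact: h1c | exact: cvg_cst].
      rewrite RintegralB //; try by apply: integrable_unit; exact: hc.
      by rewrite RintegralZr //; apply: integrable_unit; exact: h1c.
    apply: le_norm_Rintegral_unit.
      move=> s; apply: cvgB; first by apply: cvgB; exact: hc.
      by apply: cvgM; [exact: h1c | exact: cvg_cst].
    move=> s s01.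
    (* Two nested mean value theorems: first for h between x and y, then for h1 between x and c. *)
    have [c [Ac cxy ->]] := MVT_within_dist (hh1 s) Ax Ay.
    have [d [Ad dxc e]] := MVT_within_dist (hh2 s) Ax Ac.
    rewrite -mulrBl e normrM normrM -mulrA -[(y - x) ^+ 2]ger0_norm ?sqr_ge0 //.
    rewrite normrX expr2; apply: ler_pM; rewrite ?mulr_ge0 ?normr_ge0 //; first exact: h2K.
    exact: ler_wpM2r.
  + exists K => _ t _ At; apply: le_norm_Rintegral_unit; first exact: hc.
    by move=> s s01; exact: hK.
  + by move=> t _ s; exact: cvg_cst.
Qed.

End UnitIntegral.

(** * Smoothness of the logarithm *)

Definition mx_atan (R : realType) n k (A : 'M[R]_(n, k)) : 'M[R]_(n, k) :=
  let: (U, xi, W) := svd A in U *m diag_mx (map_mx atan xi) *m W^T.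

Lemma GrlogE (R : realType) n k (V0 V : 'M[R]_(n, k)) :
  Grlog V0 V = mx_atan (V *m invmx (V0^T *m V) - V0).
Proof. by []. Qed.

Lemma smooth_family_resolvent (R : realType) (A : set R) n k m (L : R -> 'M[R]_(n, k)) :
  (k <= n)%N -> smooth_family_mx A m (fun _ t => L t) ->
  smooth_family_mx A m (fun s t => L t *m invmx (1%:M + s ^+ 2 *: ((L t)^T *m L t))).
Proof.
move=> kn sL; apply: smooth_family_mulmx => //.
apply: (@smooth_family_invmx _ _ _ _ _ 1) => // [s t _|].
  by rewrite (le_trans (resolvent_det_ge1 (L t) s kn)) // ler_norm.
apply: smooth_family_mxD; first exact: smooth_family_mx_cst.
apply: smooth_family_mxZ; first by apply: smooth_family_param; exact: exprn_continuous.
by apply: smooth_family_mulmx => //; exact: smooth_family_trmx.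
Qed.

(* Matrix form of atan x = \int_0^1 x / (1 + s^2 x^2) ds: it removes the singular vectors,
   which need not depend smoothly on A. *)
Lemma mx_atan_integral (R : realType) n k (A : 'M[R]_(n, k)) i j : (k <= n)%N ->
  mx_atan A i j = \int[@lebesgue_measure R]_(s in `[0, 1])
    (A *m invmx (1%:M + s ^+ 2 *: (A^T *m A))) i j.
Proof.
move=> kn; rewrite /mx_atan; case: (svd A) (svdP A kn) => [[U xi] W] svdA.
pose f (s : R) := (A *m invmx (1%:M + s ^+ 2 *: (A^T *m A))) i j.
pose F (s : R) := (U *m diag_mx (map_mx atan (s *: xi)) *m W^T) i j.
have dF (s : R) : is_derive s (1 : R) F (f s).
  rewrite /f -(resolvent_svd s kn svdA).
  apply: is_derive_diag_sandwich => l; rewrite mxE.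
  rewrite (_ : (fun r => _) = atan \o (fun r => r * xi 0 l)); last first.
    by apply/funext => r; rewrite !mxE.
  have h : is_derive s (1 : R) (fun r => r * xi 0 l) (xi 0 l).
    by apply: is_derive_eq; rewrite scaler0 add0r /GRing.scale /= mulr1.
  have h1 := is_derive1_comp (is_derive1_atan _) h; apply: (is_derive_eq h1).
  by rewrite exprMn mulrC.
have Fc : continuous F.
  by move=> s; apply: differentiable_continuous; apply/derivable1_diffP; have [] := dF s.
(* Continuity in s is the second clause of [smooth_family], here for the constant curve A. *)
have fc : continuous f.
  have [_ h _] := @smooth_family_resolvent R setT n k 0 (fun=> A) kn
    (@smooth_family_mx_cst _ _ _ _ _ A) i j.
  exact: (h 0).
have FTC := @continuous_FTC2 R f F 0 1 ltr01 (continuous_subspaceT fc).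
rewrite /Rintegral FTC; first last.
- by move=> x _; rewrite derive1E; have [_ ->] := dF x.
- split=> [x _||]; first by have [] := dF x.
    by apply: cvg_at_right_filter; exact: Fc.
  by apply: cvg_at_left_filter; exact: Fc.
rewrite /= /F scale0r scale1r.
suff -> : map_mx atan 0 = 0 :> 'rV[R]_k.
  rewrite (_ : diag_mx 0 = 0); last by apply/matrixP => a b; rewrite !mxE mul0rn.
  by rewrite mulmx0 mul0mx [X in _ - X]mxE subr0.
by apply/matrixP => a b; rewrite !mxE atan0.
Qed.

Lemma smooth_family_mx_atan (R : realType) (a b : R) n k m (L : R -> 'M[R]_(n, k)) :
  (k <= n)%N -> smooth_family_mx `[a, b] m.+2 (fun _ t => L t) ->
  smooth_family_mx `[a, b] m (fun _ t => mx_atan (L t)).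
Proof.
move=> kn sL i j.
apply: smooth_family_ext (smooth_family_integral (smooth_family_resolvent kn sL i j)).
by move=> _ t _; rewrite mx_atan_integral.
Qed.

Lemma smooth_family_away_from0 (R : realType) (a b : R) (g : R -> R) : a <= b ->
  smooth_family `[a, b] 1 (fun _ t => g t) ->
  (forall t, `[a, b]%classic t -> g t != 0) ->
  exists2 c, 0 < c & forall t, `[a, b]%classic t -> c <= `|g t|.
Proof.
move=> ab [_ _ [g' _ gg']] g0.
have gc := has_derive_within_continuous (gg' 0).
have gnc : {within `[a, b], continuous (fun t => `|g t|)}.
  by move=> x; apply: continuous_comp; [exact: gc | exact: norm_continuous].
have [c cab hc] := EVT_min ab gnc.
by exists `|g c|; [rewrite normr_gt0 g0 | exact: hc].
Qed.

Lemma smooth_family_log_lift (R : realType) (a b : R) n k m (V0 : 'M[R]_(n, k))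
    (D : R -> 'M[R]_n) : a < b ->
  (forall i j, real_analytic_on `[a, b] (fun t => D t i j)) ->
  (forall t, `[a, b]%classic t -> V0^T *m D t *m V0 \in unitmx) ->
  smooth_family_mx `[a, b] m (fun _ t => log_lift V0 (D t)).
Proof.
move=> ab Dan Du.
have sD p : smooth_family_mx `[a, b] p (fun _ t => D t).
  by move=> i j; exact: smooth_family_analytic.
have sM p : smooth_family_mx `[a, b] p (fun _ t => V0^T *m D t *m V0).
  apply: smooth_family_mulmx; last exact: smooth_family_mx_cst.
  by apply: smooth_family_mulmx => //; exact: smooth_family_mx_cst.
have [c c0 hc] : exists2 c, 0 < c &
    forall t, `[a, b]%classic t -> c <= `|\det (V0^T *m D t *m V0)|.
  apply: smooth_family_away_from0; first exact: ltW.
    exact: (smooth_family_det (sM 1%N)).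
  by move=> t At; rewrite -unitfE -unitmxE Du.
apply: smooth_family_mxD; last exact: smooth_family_mx_cst.
apply: smooth_family_mulmx.
  by apply: smooth_family_mulmx => //; exact: smooth_family_mx_cst.
by apply: smooth_family_invmx c0 _ _ => // _ t; exact: hc.
Qed.

Lemma smooth_family_derive1_within (R : realType) (a b : R) m (f : R -> R) : a < b ->
  smooth_family `[a, b] m.+1 (fun _ t => f t) ->
  smooth_family `[a, b] m (fun _ t => derive1_within `[a, b] f t) /\
  forall x, `[a, b]%classic x -> has_derive_within `[a, b] f x (derive1_within `[a, b] f x).
Proof.
move=> ab [_ _ [f' sf' ff']].
(* The derivative supplied by [smooth_family] could a priori depend on s although f does not;
   uniqueness of the limit excludes this on [a, b]. *)
have f'E s x : `[a, b]%classic x -> derive1_within `[a, b] f x = f' s x.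
  move=> Ax; apply: (derive1_withinE _ (ff' s x Ax)); exact: itv_within_proper.
split; first by apply: smooth_family_ext sf' => s t At; rewrite -f'E.
by move=> x Ax; rewrite (f'E 0 x Ax); exact: ff'.
Qed.

Lemma smooth_family_iter (R : realType) (a b : R) m d (f : R -> R) : a < b ->
  smooth_family `[a, b] (d + m) (fun _ t => f t) ->
  smooth_family `[a, b] m (fun _ t => iter d (derive1_within `[a, b]) f t).
Proof.
move=> ab; elim: d m => [|d IH] m // sf.
rewrite addSnnS in sf.
by have [] := smooth_family_derive1_within ab (IH m.+1 sf).
Qed.

(** * Lagrange interpolation at Chebyshev nodes *)

Lemma has_derive_within_sum (R : realType) (A : set R) (I : Type) (r : seq I)
    (f : I -> R -> R) (df : I -> R) (x : R) :
  (forall i, has_derive_within A (f i) x (df i)) ->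
  has_derive_within A (fun y => \sum_(i <- r) f i y) x (\sum_(i <- r) df i).
Proof.
move=> fd; elim: r => [|i r IH].
  rewrite big_nil (_ : (fun y => _) = fun=> 0); first exact: has_derive_within_cst.
  by apply/funext => y; rewrite big_nil.
rewrite big_cons (_ : (fun y => _) = fun y => f i y + \sum_(j <- r) f j y).
  exact: has_derive_withinD.
by apply/funext => y; rewrite big_cons.
Qed.

Lemma has_derive_withinZ (R : realType) (A : set R) (c : R) (f : R -> R) (x l : R) :
  has_derive_within A f x l -> has_derive_within A (fun y => c * f y) x (c * l).
Proof.
move=> fl; have := has_derive_withinM (has_derive_within_cst A c x) fl.
by rewrite mul0r add0r.
Qed.

(** One zero of the derivative is found between each two consecutive zeros. Recording that the new
    zeros lie to the right of x keeps the list sorted when the next one is put in front. *)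
Lemma rolle_zeros (R : realType) (a b : R) (f g : R -> R) (x : R) (s : seq R) :
  (forall t, `[a, b]%classic t -> has_derive_within `[a, b] f t (g t)) ->
  path <%R x s -> (forall y, y \in x :: s -> `[a, b]%classic y /\ f y = 0) ->
  exists s', [/\ size s' = size s, path <%R x s' &
    forall y, y \in s' -> `[a, b]%classic y /\ g y = 0].
Proof.
move=> fg; elim: s x => [|y s IH] x /=; first by exists [::].
move=> /andP[xy ys] h.
have [s' [ss' ps' hs']] := IH y ys (fun z zs => h z (@mem_behead _ (x :: y :: s) z zs)).
have [] := h x (mem_head _ _); rewrite /= in_itv /= => /andP[ax _] fx.
have [] := h y (@mem_behead _ (x :: y :: s) _ (mem_head _ _)).
rewrite /= in_itv /= => /andP[_ yb] fy.
have [c /andP[xc cy] e] := MVT_within fg ax xy yb.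
exists (c :: s'); split => /=; first by rewrite ss'.
- by rewrite xc /=; move: ps'; case: (s') => //= z s'' /andP[yz ->]; rewrite (lt_trans cy yz).
- move=> z; rewrite inE => /orP[/eqP ->|]; last exact: hs'.
  rewrite in_itv /= (le_trans ax (ltW xc)) (le_trans (ltW cy) yb); split => //.
  move: e; rewrite fx fy subrr => /esym/eqP; rewrite mulf_eq0 => /orP[/eqP //|].
  by rewrite subr_eq0 gt_eqF.
Qed.

Lemma iterated_rolle (R : realType) (a b : R) (m : nat) (G : nat -> R -> R) (s : seq R) :
  (forall d t, (d < m)%N -> `[a, b]%classic t -> has_derive_within `[a, b] (G d) t (G d.+1 t)) ->
  uniq s -> size s = m.+1 -> (forall y, y \in s -> `[a, b]%classic y /\ G 0%N y = 0) ->
  exists2 c, `[a, b]%classic c & G m c = 0.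
Proof.
move=> dG us ss zs.
have {us ss zs} : exists2 s, sorted <%R s /\ size s = m.+1 &
    forall y, y \in s -> `[a, b]%classic y /\ G 0%N y = 0.
  exists (sort <=%R s); first by rewrite sort_lt_sorted size_sort.
  by move=> y; rewrite mem_sort; exact: zs.
elim: m G dG => [|m IH] G dG [[|x s'] [px sz] zs] //.
  by have [Ax Gx] := zs x (mem_head _ _); exists x.
have [s2 [s2s p2 z2]] := rolle_zeros (fun t At => dG 0%N t (ltn0Sn m) At) px zs.
apply: (IH (fun d => G d.+1)) => [d t dm At|]; first exact: dG.
exists s2 => //; split; first exact: path_sorted p2.
by rewrite s2s; case: sz.
Qed.

Lemma derivn_top_coef (R : realType) (q : {poly R}) (m : nat) :
  (size q <= m.+1)%N -> q^`(m) = (q`_m *+ m`!)%:P.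
Proof.
move=> sq; apply/polyP => i; rewrite coef_derivn coefC; case: i => [|i] /=.
  by rewrite addn0 ffactnn.
by rewrite nth_default ?mul0rn // (leq_trans sq) // addnS ltnS leq_addr.
Qed.

(** The classical argument: with w the node polynomial, w(t) (F - p) - (F(t) - p(t)) w vanishes at t
    and at the N + 1 nodes, so its derivative of order N + 1 has a zero c. Scaling by w(t) avoids a
    division, and in that derivative only the leading coefficient of w survives from the polynomial
    part. *)
Lemma interpolation_error (R : realType) (a b : R) (N : nat) (x : 'I_N.+1 -> R)
    (F : nat -> R -> R) (p : {poly R}) (t : R) :
  injective x -> (forall i, `[a, b]%classic (x i)) ->
  (forall d u, (d < N.+1)%N -> `[a, b]%classic u ->
     has_derive_within `[a, b] (F d) u (F d.+1 u)) ->
  (size p <= N.+1)%N -> (forall i, p.[x i] = F 0%N (x i)) ->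
  `[a, b]%classic t ->
  exists2 c, `[a, b]%classic c &
    (F 0%N t - p.[t]) * N.+1`!%:R = F N.+1 c * \prod_i (t - x i).
Proof.
move=> xinj xA dF sp px At.
pose w : {poly R} := \prod_(i < N.+1) ('X - (x i)%:P).
have wE u : w.[u] = \prod_i (u - x i).
  by rewrite horner_prod; apply: eq_bigr => i _; rewrite hornerXsubC.
have wx i : w.[x i] = 0 by rewrite wE (bigD1 i) //= subrr mul0r.
(* If t is a node, both sides are 0 and any point serves as c. *)
have [[i ti]|tx] := pselect (exists i, t = x i).
  by exists t => //; rewrite -wE ti wx px subrr mul0r mulr0.
have sw : size w = N.+2.
  by rewrite /w size_prod_XsubC [index_enum _]unlock -enumT size_enum_ord.
have wmonic : w \is monic by apply: monic_prod_XsubC.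
pose e := F 0%N t - p.[t].
pose q := w.[t] *: p + e *: w.
have sq : (size q <= N.+2)%N.
  rewrite (leq_trans (size_polyD _ _)) // geq_max !(leq_trans (size_scale_leq _ _)) ?sw //.
  exact: leqW.
pose G d u := w.[t] * F d u + (-1) * (q^`(d)).[u].
have [c Ac Gc] : exists2 c, `[a, b]%classic c & G N.+1 c = 0.
  apply: (@iterated_rolle _ a b _ G (t :: [seq x i | i <- enum 'I_N.+1])).
  - move=> d u dN Au; apply: has_derive_withinD; apply: has_derive_withinZ.
      exact: dF.
    by rewrite derivnS; apply: is_derive_has_within; exact: is_derive_poly.
  - rewrite /= map_inj_uniq // enum_uniq andbT; apply/mapP => -[i _ ti].
    by apply: tx; exists i.
  - by rewrite /= size_map size_enum_ord.
  - move=> y; rewrite inE => /orP[/eqP ->|/mapP[i _ ->]]; split => //.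
      by rewrite /G derivn0 /q !hornerE /e; ring.
    by rewrite /G derivn0 /q !hornerE wx px; ring.
exists c => //; rewrite -wE; apply/esym/eqP; rewrite mulrC -subr_eq0 -Gc /G.
rewrite derivn_top_coef // hornerC mulN1r /q coefD !coefZ.
rewrite (nth_default _ sp) mulr0 add0r.
have -> : w`_N.+1 = 1 by move/monicP: wmonic; rewrite /lead_coef sw.
by rewrite mulr1 mulr_natr.
Qed.

Definition lagrange_poly (R : realType) (N : nat) (x : 'I_N.+1 -> R) (j : 'I_N.+1) : {poly R} :=
  \prod_(i < N.+1 | i != j) ((x j - x i)^-1 *: ('X - (x i)%:P)).

Lemma horner_lagrange_poly (R : realType) N (x : 'I_N.+1 -> R) j t :
  (lagrange_poly x j).[t] = lagrange_basis x j t.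
Proof.
by rewrite horner_prod; apply: eq_bigr => i _; rewrite hornerZ hornerXsubC mulrC.
Qed.

Lemma size_lagrange_poly (R : realType) N (x : 'I_N.+1 -> R) j :
  (size (lagrange_poly x j) <= N.+1)%N.
Proof.
apply: leq_trans (size_poly_prod_leq _ _) _.
have cN : #|[pred i : 'I_N.+1 | i != j]| = N by rewrite cardC1 card_ord.
rewrite leq_subLR cN.
have : (\sum_(i < N.+1 | i != j) size ((x j - x i)^-1 *: ('X - (x i)%:P)) <=
    \sum_(i < N.+1 | i != j) 2)%N.
  by apply: leq_sum => i _; rewrite (leq_trans (size_scale_leq _ _)) // size_XsubC.
rewrite sum_nat_const cN => h.
by rewrite addnS ltnS (leq_trans h) // muln2 addnn.
Qed.

Lemma lagrange_basis_node (R : realType) N (x : 'I_N.+1 -> R) j l : injective x ->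
  lagrange_basis x j (x l) = (l == j)%:R.
Proof.
move=> xinj; rewrite /lagrange_basis; have [->|lj] := eqVneq l j.
  apply: big1 => i ij; rewrite divff // subr_eq0; apply: contra_neq ij.
  by move/xinj.
by rewrite (bigD1 l) //= subrr mul0r mul0r.
Qed.

Lemma deriven_within_mxE (R : realType) (A : set R) n k d (F : R -> 'M[R]_(n, k)) t i j :
  deriven_within_mx A d F t i j = iter d (derive1_within A) (fun t => F t i j) t.
Proof. by rewrite mxE. Qed.

(** Without an upper bound [sup] would not dominate the members of the set; the bound comes
    entrywise from [smooth_family]. *)
Lemma frobenius_deriven_bounded (R : realType) (a b : R) n k d (F : R -> 'M[R]_(n, k)) :
  a < b -> smooth_family_mx `[a, b] d (fun _ t => F t) ->
  has_ubound [set frobenius (deriven_within_mx `[a, b] d F tau) | tau in `[a, b]%classic].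
Proof.
move=> ab sF.
have : forall ij : 'I_n * 'I_k, exists K, forall t, `[a, b]%classic t ->
    `|iter d (derive1_within `[a, b]) (fun t => F t ij.1 ij.2) t| <= K.
  move=> [i j]; have := sF i j; rewrite -[X in smooth_family _ X]addn0 => sij.
  have [[K hK] _ _] := smooth_family_iter ab sij.
  by exists K => t At; apply: (hK 0) => //; rewrite lexx ler01.
move=> /boolp.choice[K hK].
exists (Num.sqrt (\sum_i \sum_j K (i, j) ^+ 2)) => _ [t At <-].
apply: ler_wsqrtr; apply: ler_sum => i _; apply: ler_sum => j _.
rewrite deriven_within_mxE -real_normK ?num_real // lerXn2r ?nnegrE ?normr_ge0 //.
  exact: le_trans (hK (i, j) t At).
exact: (hK (i, j) t At).
Qed.

(* Pairing with the error E at the evaluation point reduces the Frobenius norm to the scalar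
   remainder formula at a single intermediate point, so no constant depending on n, k is lost. *)
Lemma lagrange_interp_error (R : realType) (a b : R) n k (N : nat) (x : 'I_N.+1 -> R)
    (F : R -> 'M[R]_(n, k)) (t : R) :
  a < b -> injective x -> (forall i, `[a, b]%classic (x i)) ->
  smooth_family_mx `[a, b] N.+1 (fun _ t => F t) -> `[a, b]%classic t ->
  frobenius (F t - lagrange_interp x (fun j => F (x j)) t) * N.+1`!%:R <=
    sup [set frobenius (deriven_within_mx `[a, b] N.+1 F tau) | tau in `[a, b]%classic] *
    `|\prod_i (t - x i)|.
Proof.
move=> ab xinj xA sF At; set B := sup _; set E := F t - _.
have Bge c : `[a, b]%classic c -> frobenius (deriven_within_mx `[a, b] N.+1 F c) <= B.
  move=> Ac; apply: ub_le_sup; first exact: frobenius_deriven_bounded.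
  by exists c.
have B0 : 0 <= B by apply: le_trans (Bge t At); exact: frobenius_ge0.
(* [E] is frozen at the evaluation point t, so [G d] is the derivative of order d of the scalar
   function u |-> <E, F u>, whose interpolation error at t is <E, E>. *)
pose G d u := \tr (E^T *m deriven_within_mx `[a, b] d F u).
have dG d u : (d < N.+1)%N -> `[a, b]%classic u ->
    has_derive_within `[a, b] (G d) u (G d.+1 u).
  move=> dN Au; rewrite /G trace_trmulE (_ : (fun u => _) = fun u => \sum_i \sum_j
     (E i j * iter d (derive1_within `[a, b]) (fun t => F t i j) u)); last first.
    apply/funext => v; rewrite trace_trmulE.
    by apply: eq_bigr => i _; apply: eq_bigr => j _; rewrite deriven_within_mxE.
  apply: has_derive_within_sum => i; apply: has_derive_within_sum => j.
  rewrite deriven_within_mxE; apply: has_derive_withinZ => /=.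
  have sij : smooth_family `[a, b] (d + (N - d).+1) (fun _ t => F t i j).
    by rewrite addnS subnKC //; exact: sF.
  by have [_] := smooth_family_derive1_within ab (smooth_family_iter ab sij); exact.
have G0 u : G 0%N u = \tr (E^T *m F u).
  rewrite /G !trace_trmulE; apply: eq_bigr => i _; apply: eq_bigr => j _.
  by rewrite deriven_within_mxE.
pose p : {poly R} := \sum_l (\tr (E^T *m F (x l))) *: lagrange_poly x l.
have pE u : p.[u] = \tr (E^T *m lagrange_interp x (fun j => F (x j)) u).
  rewrite /p /lagrange_interp horner_sum mulmx_sumr linear_sum /=.
  apply: eq_bigr => l _; rewrite hornerZ horner_lagrange_poly.
  by rewrite -scalemxAr mxtraceZ mulrC.
have sp : (size p <= N.+1)%N.
  apply: leq_trans (size_sum _ _ _) _; apply/bigmax_leqP => l _.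
  exact: leq_trans (size_scale_leq _ _) (size_lagrange_poly x l).
have px i : p.[x i] = G 0%N (x i).
  rewrite G0 pE /lagrange_interp (bigD1 i) //= lagrange_basis_node // eqxx scale1r.
  rewrite big1 ?addr0 // => j ji.
  by rewrite lagrange_basis_node // eq_sym (negbTE ji) scale0r.
have [c Ac e] := interpolation_error xinj xA dG sp px At.
have eE : frobenius E ^+ 2 * N.+1`!%:R = G N.+1 c * \prod_i (t - x i).
  by rewrite -e G0 pE sqr_frobenius -linearB /= -mulmxBr.
have [E0|E0] := eqVneq (frobenius E) 0.
  by rewrite E0 mul0r mulr_ge0.
have Epos : 0 < frobenius E by rewrite lt_neqAle eq_sym E0 frobenius_ge0.
rewrite -(ler_pM2l Epos) mulrA -expr2 eE (le_trans (ler_norm _)) // normrM mulrA.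
rewrite ler_wpM2r // ler_norml; apply/andP; split.
  (* The lower bound is Cauchy-Schwarz for - E. *)
  rewrite lerNl; have <- : \tr ((- E)^T *m deriven_within_mx `[a, b] N.+1 F c) = - G N.+1 c.
    rewrite /G !trace_trmulE -sumrN; apply: eq_bigr => i _.
    by rewrite -sumrN; apply: eq_bigr => j _; rewrite [(- E) i j]mxE mulNr.
  apply: le_trans (frobenius_CS _ _) _.
  have -> : frobenius (- E) = frobenius E.
    by rewrite /frobenius; congr Num.sqrt; apply: eq_bigr => i _; apply: eq_bigr => j _;
      rewrite mxE sqrrN.
  by rewrite ler_wpM2l ?frobenius_ge0 // Bge.
by apply: le_trans (frobenius_CS _ _) _; rewrite ler_wpM2l ?frobenius_ge0 // Bge.
Qed.

(** * Chebyshev polynomials *)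

Fixpoint chebyshev_poly (R : realType) (n : nat) : {poly R} :=
  if n is n1.+1 then
    if n1 is n2.+1 then 2 *: ('X * chebyshev_poly R n1) - chebyshev_poly R n2 else 'X
  else 1.

Lemma chebyshev_poly_cos (R : realType) (n : nat) (th : R) :
  (chebyshev_poly R n).[cos th] = cos (n%:R * th).
Proof.
suff [] : (chebyshev_poly R n).[cos th] = cos (n%:R * th) /\
          (chebyshev_poly R n.+1).[cos th] = cos (n.+1%:R * th) by [].
elim: n => [|n [IH0 IH1]]; first by rewrite /= hornerC mul0r cos0 hornerX mul1r.
split => //; rewrite [chebyshev_poly R n.+2]/= -/(chebyshev_poly R n.+1).
rewrite !hornerE IH0 IH1.
have -> : n%:R * th = n.+1%:R * th - th by rewrite -[n.+1%:R]natr1; ring.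
have -> : n.+2%:R * th = n.+1%:R * th + th by rewrite -[n.+2%:R]natr1 mulrDl mul1r.
by rewrite cosB cosD /=; ring.
Qed.

Lemma size_chebyshev_poly_leq (R : realType) (n : nat) :
  (size (chebyshev_poly R n) <= n.+1)%N.
Proof.
suff /andP[] : ((size (chebyshev_poly R n) <= n.+1) &&
                (size (chebyshev_poly R n.+1) <= n.+2))%N by [].
elim: n => [|n /andP[IH0 IH1]]; first by rewrite /= size_poly1 size_polyX.
rewrite IH1 /= -/(chebyshev_poly R n.+1) (leq_trans (size_polyD _ _)) // geq_max.
rewrite size_polyN (leq_trans IH0) ?andbT; last exact: ltnW (leqnSn _).
by rewrite (leq_trans (size_scale_leq _ _)) // mulrC (leq_trans (size_polyMleq _ _)) //
  size_polyX addn2.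
Qed.

Lemma chebyshev_poly_lead (R : realType) (n : nat) :
  (chebyshev_poly R n.+1)`_n.+1 = 2 ^+ n.
Proof.
elim: n => [|n IH]; first by rewrite /= coefX expr0.
rewrite [chebyshev_poly R n.+2]/= -/(chebyshev_poly R n.+1).
rewrite coefB coefZ coefXM /= IH [X in _ - X]nth_default ?subr0 ?exprS //.
exact: leq_trans (size_chebyshev_poly_leq R n) _.
Qed.

Lemma cheb_angle_itv (R : realType) (N : nat) (i : 'I_N.+1) :
  (2 * i + 1)%:R / (2 * N + 2)%:R * pi \in `[0, pi : R].
Proof.
rewrite in_itv /= mulr_ge0 ?divr_ge0 ?ler0n ?pi_ge0 //=.
rewrite ler_piMl ?pi_ge0 // ler_pdivrMr ?mul1r ?ler_nat ?ltr0n ?addn2 //.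
by have := ltn_ord i; rewrite ltnS => iN; rewrite addn1 ltnS leqW // leq_mul2l.
Qed.

Lemma cheb_node_inj (R : realType) (N : nat) : injective (@cheb_node R N).
Proof.
move=> i j /(cos_inj (cheb_angle_itv R i) (cheb_angle_itv R j)).
move=> /(mulIf (lt0r_neq0 (pi_gt0 R))) /mulIf.
rewrite invr_eq0 pnatr_eq0 addn2 => /(_ isT) /eqP; rewrite eqr_nat eqn_add2r eqn_pmul2l //.
by move=> /eqP; exact: val_inj.
Qed.

Lemma cheb_node_itv (R : realType) (N : nat) (i : 'I_N.+1) :
  `[-1, 1]%classic (@cheb_node R N i).
Proof. by rewrite /= in_itv /= cos_geN1 cos_le1. Qed.

Lemma chebyshev_poly_node (R : realType) (N : nat) (i : 'I_N.+1) :
  (chebyshev_poly R N.+1).[@cheb_node R N i] = 0.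
Proof.
rewrite chebyshev_poly_cos.
have -> : N.+1%:R * ((2 * i + 1)%:R / (2 * N + 2)%:R * pi) = pi / 2 + i%:R * pi :> R.
  have N0 : N%:R + 1 != 0 :> R by rewrite natr1 pnatr_eq0.
  rewrite [(2 * i + 1)%:R]natrD [(2 * N + 2)%:R]natrD ![(2 * _)%:R]natrM -[N.+1%:R]natr1. field.
  by have -> : 2 * N%:R + 2 = 2 * (N%:R + 1) :> R by ring; rewrite mulf_neq0 ?pnatr_eq0.
elim: (nat_of_ord i) => [|m IH]; first by rewrite mul0r addr0 cos_pihalf.
have -> : pi / 2 + m.+1%:R * pi = pi / 2 + m%:R * pi + pi :> R.
  by rewrite -[m.+1%:R]natr1; ring.
by rewrite cosDpi IH oppr0.
Qed.

(** The Chebyshev polynomial of degree N + 1 has the N + 1 distinct nodes as roots and leading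
    coefficient 2^N, so it is 2^N times the node polynomial; writing t = cos(acos t) shows that it
    is bounded by 1 on [-1, 1]. *)
Lemma cheb_node_prod_le (R : realType) (N : nat) (t : R) : `[-1, 1]%classic t ->
  `|\prod_i (t - @cheb_node R N i)| <= (2 ^+ N)^-1.
Proof.
rewrite /= in_itv /= => t1.
pose rs := [seq @cheb_node R N i | i <- enum 'I_N.+1].
have p2 : (2 : R) ^+ N != 0 by rewrite expf_neq0.
have sT : size (chebyshev_poly R N.+1) = N.+2.
  apply/eqP; rewrite eqn_leq size_chebyshev_poly_leq /= ltnNge; apply/negP => s.
  by have := chebyshev_poly_lead R N; rewrite nth_default // => /esym/eqP; rewrite (negbTE p2).
have : chebyshev_poly R N.+1 =
    lead_coef (chebyshev_poly R N.+1) *: \prod_(z <- rs) ('X - z%:P).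
  apply: all_roots_prod_XsubC.
  - by rewrite sT size_map size_enum_ord.
  - by apply/allP => _ /mapP[i _ ->]; rewrite /root chebyshev_poly_node.
  - by rewrite uniq_rootsE map_inj_uniq ?enum_uniq //; exact: cheb_node_inj.
rewrite /lead_coef sT chebyshev_poly_lead big_map big_enum => e.
have -> : \prod_i (t - @cheb_node R N i) = (2 ^+ N)^-1 * (chebyshev_poly R N.+1).[t].
  rewrite e hornerZ mulKf // horner_prod.
  by apply: eq_bigr => i _; rewrite hornerXsubC.
rewrite normrM ger0_norm ?invr_ge0 ?exprn_ge0 // ler_piMr ?invr_ge0 ?exprn_ge0 //.
have tin : t \in `[-1, 1] by rewrite in_itv.
rewrite -(acosK tin) chebyshev_poly_cos.
by rewrite ler_norml cos_geN1 cos_le1.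
Qed.

(** * The error bound *)

Lemma GrexpE (R : realType) n k (V0 Delta : 'M[R]_(n, k)) :
  Grexp V0 Delta = exp_curve V0 (svd Delta) 1.
Proof. by rewrite /Grexp /exp_curve; case: (svd Delta) => [[U xi] W]; rewrite scale1r. Qed.

(** The witness is (U, atan xi, W), with (U, xi, W) the chosen SVD of the lift; it need not be the
    triple that [svd] selects for the logarithm itself. *)
Lemma Grlog_thin_svd (R : realType) n k (V0 V : 'M[R]_(n, k)) : (k <= n)%N ->
  V0^T *m V0 = 1%:M -> V^T *m V = 1%:M -> V0^T *m V \in unitmx ->
  V0^T *m Grlog V0 V = 0 /\
  exists2 s, thin_svd (Grlog V0 V) s &
    exp_curve V0 s 1 *m (exp_curve V0 s 1)^T = V *m V^T.
Proof.
move=> kn V0V0 VV Mu; rewrite GrlogE /mx_atan; set L := _ - _.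
case: (svd L) (svdP L kn) => [[U xi] W] svdL; split.
  apply: thin_svd_tangent svdL _ => [|j e]; last by rewrite mxE e atan0.
  exact: lift_tangent.
exists (U, map_mx atan xi, W); first exact: thin_svd_atan svdL.
exact: exp_log_projector svdL.
Qed.

Theorem mainTheorem1 (R : realType) :
  exists2 C : R, 0 < C &
  forall (n k N : nat) (hk : (1 <= k)%N) (hkn : (k <= n)%N)
    (S : R -> {vspace 'cV[R]_n}) (D : R -> 'M[R]_n)
    (Vnode : 'I_N.+1 -> 'M[R]_(n, k)) (V0 : 'M[R]_(n, k))
    (V : R -> 'M[R]_(n, k)) (sigma_min : R),
  let I : set R := `[-1, 1]%classic in
  let t_ := @cheb_node R N in
  let Delta := fun t : R => Grlog V0 (V t) in
  let Delta_interp :=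
    lagrange_interp t_ (fun j => Grlog V0 (Vnode j)) in
  let V_interp := fun t : R => Grexp V0 (Delta_interp t) in
  (forall t, I t -> grassmann k (S t)) ->
  (forall t, I t -> is_orthproj (S t) (D t)) ->
  (forall i, stiefel_rep (S (t_ i)) (Vnode i)) ->
  stiefel V0 ->
  (forall t, I t -> stiefel_rep (S t) (V t)) ->
  (forall i j, real_analytic_on I (fun t => D t i j)) ->
  (forall t, I t -> forall Vt : 'M[R]_(n, k), stiefel_rep (S t) Vt ->
    \rank (Vt^T *m V0) = k) ->
  0 < sigma_min ->
  (forall t, I t -> sigma_min <= singular_value (Delta t) k) ->
  forall t, I t -> forall Vt : 'M[R]_(n, k), stiefel_rep (S t) Vt ->
    frobenius (Vt *m Vt^T - V_interp t *m (V_interp t)^T) <=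
      4 * (4 * C / sigma_min + 1) *
      (sup [set frobenius (deriven_within_mx I N.+1 Delta tau) | tau in I]
        / (2 ^+ N * (N.+1)`!%:R)).
Proof.
exists 1; first exact: ltr01.
move=> n k N hk hkn S D Vnode V0 V sigma I t_ Delta Dint Vint _ hD hVn V0V0 hV Dan rk
  sigma0 _ t It Vt hVt.
have Mu u W : I u -> stiefel_rep (S u) W -> V0^T *m W \in unitmx.
  move=> Iu hW; rewrite -unitmx_tr trmxM trmxK -row_free_unit /row_free.
  by rewrite (rk u Iu W hW).
have t_I j : I (t_ j) by exact: cheb_node_itv.
have VD u (W : 'M[R]_(n, k)) : I u -> stiefel_rep (S u) W -> W *m W^T = D u.
  by move=> Iu hW; apply: stiefel_rep_projector hW _; exact: hD.
have DeltaE u : I u -> Delta u = mx_atan (log_lift V0 (D u)).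
  move=> Iu; rewrite /Delta GrlogE log_liftE; last exact: Mu Iu (hV u Iu).
  by rewrite (VD u (V u) Iu (hV u Iu)).
have sDelta : smooth_family_mx I N.+1 (fun _ t => Delta t).
  move=> i j; apply: (@smooth_family_ext _ _ _ (fun _ u => mx_atan (log_lift V0 (D u)) i j)).
    by move=> _ u Iu; rewrite DeltaE.
  apply: smooth_family_mx_atan => //; apply: smooth_family_log_lift => // u Iu.
  rewrite -(VD u (V u) Iu (hV u Iu)).
  have -> : V0^T *m (V u *m (V u)^T) *m V0 = (V0^T *m V u) *m (V0^T *m V u)^T.
    by rewrite trmxM trmxK !mulmxA.
  by rewrite unitmx_mul unitmx_tr !(Mu u (V u) Iu (hV u Iu)).
(* The prescribed [Vnode j] and [V (t_ j)] may differ by an orthogonal factor, which the logarithm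
   does not see. *)
have DintE : Dint t = lagrange_interp t_ (fun j => Delta (t_ j)) t.
  apply: eq_bigr => j _; congr (_ *: _).
  apply: Grlog_eq_projector; first exact: Mu (t_I j) (hVn j).
    exact: Mu (t_I j) (hV _ (t_I j)).
  by rewrite (VD _ _ (t_I j) (hVn j)) (VD _ _ (t_I j) (hV _ (t_I j))).
have logs u : I u -> V0^T *m Delta u = 0 /\ exists2 s, thin_svd (Delta u) s &
    exp_curve V0 s 1 *m (exp_curve V0 s 1)^T = V u *m (V u)^T.
  move=> Iu; apply: Grlog_thin_svd => //; first by case: (hV u Iu).
  exact: Mu Iu (hV u Iu).
have V0Dint : V0^T *m Dint t = 0.
  rewrite DintE /lagrange_interp mulmx_sumr big1 // => j _.
  by rewrite -scalemxAr (logs _ (t_I j)).1 scaler0.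
have [V0Delta [s svds es]] := logs t It.
rewrite (VD t Vt It hVt) -(VD t (V t) It (hV t It)) -es /Vint GrexpE.
apply: le_trans (exp_projector_lipschitz V0V0 V0Delta V0Dint svds (svdP _ hkn)) _.
set B := sup _.
have err : frobenius (Delta t - Dint t) <= B / (2 ^+ N * N.+1`!%:R).
  have f0 : 0 < N.+1`!%:R :> R by rewrite ltr0n fact_gt0.
  have p0 : 0 < 2 ^+ N :> R by rewrite exprn_gt0.
  rewrite invfM mulrA ler_pdivlMr // DintE.
  apply: le_trans (lagrange_interp_error _ (@cheb_node_inj R N) _ sDelta It) _ => //.
  rewrite ler_wpM2l ?cheb_node_prod_le //.
  (* Nonnegativity of B, through the member of the set given by t. *)
  apply: (@le_trans _ _ (frobenius (deriven_within_mx I N.+1 Delta t))).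
    exact: frobenius_ge0.
  apply: ub_le_sup; last by exists t.
  by apply: frobenius_deriven_bounded.
have s0 : 0 <= 4 * 1 / sigma by rewrite mulr1 divr_ge0 // ltW.
apply: le_trans (_ : 4 * (B / (2 ^+ N * N.+1`!%:R)) <= _); first by rewrite ler_pM2l.
have e0 := le_trans (frobenius_ge0 _) err.
by rewrite -mulrA ler_pM2l // ler_peMl // lerDr.
Qed.
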